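(* Let $\mathfrak{n}_{6,2}\oplus\mathbb{R}=(0,0,0,0,f^{12},f^{14}+f^{23},0)$ be endowed with the metric $$g=f^1\odot f^1+f^2\odot f^2+f^3\odot f^3+r\,f^4\odot f^4+E\,f^5\odot f^5+2F\,f^5\odot f^6+G\,f^6\odot f^6+f^7\odot f^7,$$ where $0<r\le1$, $E,F,G\ge0$ and $EG-F^2>0$. Then there exists a purely coclosed $\mathrm{G}_2$-structure $\varphi$ on $\mathfrak{n}_{6,2}\oplus\mathbb{R}$ such that $g_\varphi=g$ if and only if $F=0$ and either $G=E\frac{r}{(\sqrt r+1)^2}$ and $0<r\le1$, or $G=E\frac{r}{(\sqrt r-1)^2}$ with $0<r<1$.
   Context: Lie algebras are real and described by the tuple $(\mathrm{d}f^1,\dots,\mathrm{d}f^7)$ for a basis $\{f^1,\dots,f^7\}$ of $\mathfrak{n}^*$, with $f^{ij}=f^i\wedge f^j$; $\mathrm{d}$ is the Chevalley-Eilenberg differential ($\mathrm{d}\alpha(x,y)=-\alpha([x,y])$ for $\alpha\in\mathfrak{n}^*$, extended as a graded derivation of $\Lambda^\bullet\mathfrak{n}^*$). The symmetric product is $f^i\odot f^j=\frac12(f^i\otimes f^j+f^j\otimes f^i)$. A $\mathrm{G}_2$-structure on a $7$-dimensional real vector space $V$ is a $3$-form $\varphi\in\Lambda^3V^*$ such that $(v\lrcorner\varphi)\wedge(v\lrcorner\varphi)\wedge\varphi\neq0$ for all $v\in V\smallsetminus\{0\}$. It determines a unique inner product $g_\varphi$ and orientation, with volume form $\mathrm{vol}_\varphi$,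 such that $g_\varphi(v,w)\mathrm{vol}_\varphi=\frac16\,(v\lrcorner\varphi)\wedge(w\lrcorner\varphi)\wedge\varphi$; $*_\varphi$ is the corresponding Hodge operator. A $\mathrm{G}_2$-structure $\varphi$ on $\mathfrak{n}$ is purely coclosed if $\mathrm{d}*_\varphi\varphi=0$ and $\mathrm{d}\varphi\wedge\varphi=0$. *)

(* Defs.v *)
From HB Require Import structures.
From mathcomp Require Import all_boot all_order all_algebra.
From mathcomp Require Import reals ring.
From mathcomp Require classical_sets.

Set Implicit Arguments.
Unset Strict Implicit.
Unset Printing Implicit Defensive.

Import Order.TTheory GRing.Theory Num.Theory.
Local Open Scope ring_scope.

(* The exterior algebra of the dual of R^n, in coordinates: a I is the
   coefficient of f^{i_1} /\ ... /\ f^{i_k} for I = {i_1 < ... < i_k}, where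
   f^0, ..., f^(n-1) is the dual of the standard basis of 'rV[R]_n.
   The regular module R^o provides the scaling of forms. *)
Notation extform R n := {ffun {set 'I_n} -> R^o}.

Section ExteriorAlgebra.
Variables (R : realType) (n : nat).
Implicit Types (a b : extform R n) (I J K : {set 'I_n}) (v w x y z : 'rV[R]_n).

Definition mono I : extform R n := [ffun J => (J == I)%:R].

Definition covec (i : 'I_n) : extform R n := mono [set i].

Definition homog (k : nat) a : Prop := forall I, #|I| != k -> a I = 0.

(* f^I /\ f^J = (-1)^(inversions I J) f^(I :|: J) for I and J disjoint. *)
Definition inversions I J : nat :=
  #|[set p in setX I J | (p.2 < p.1)%N]|.

Definition wedge a b : extform R n :=
  [ffun K : {set 'I_n} => \sum_(I : {set 'I_n} | I \subset K)
     (-1) ^+ inversions I (K :\: I) * a I * b (K :\: I)].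

(* The vector is inserted in the first slot:
   (v _| a)(w_2, ..., w_k) = a(v, w_2, ..., w_k). *)
Definition contract v a : extform R n :=
  [ffun J : {set 'I_n} => \sum_(i < n | i \notin J)
     (-1) ^+ inversions [set i] J * v 0 i * a (i |: J)].

Definition lie_bracket (br : 'rV[R]_n -> 'rV[R]_n -> 'rV[R]_n) : Prop :=
  [/\ forall (c : R) x y z, br (c *: x + y) z = c *: br x z + br y z,
      forall x, br x x = 0,
      forall x y, br x y = - br y x
    & forall x y z, br x (br y z) + br y (br z x) + br z (br x y) = 0].

(* d f^k, from d alpha (x, y) = - alpha ([x, y]). *)
Definition ce_covec (br : 'rV[R]_n -> 'rV[R]_n -> 'rV[R]_n) (k : 'I_n) :
    extform R n :=
  \sum_(i < n) \sum_(j < n | (i < j)%N)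
    (- (br (delta_mx 0 i) (delta_mx 0 j)) 0 k) *: wedge (covec i) (covec j).

(* Chevalley-Eilenberg differential: the graded Leibniz rule on each monomial,
   d (f^I) = \sum_(i in I) (-1)^(rank of i in I) d f^i /\ f^(I :\ i), the 2-form
   d f^i having been moved to the front. *)
Definition ce_diff (br : 'rV[R]_n -> 'rV[R]_n -> 'rV[R]_n) a : extform R n :=
  \sum_(I : {set 'I_n}) a I *:
    \sum_(i in I) (-1) ^+ inversions [set i] (I :\ i) *:
      wedge (ce_covec br i) (mono (I :\ i)).

(* Bilinear forms on 'rV[R]_n are given by their Gram matrices. *)
Definition bilin (g : 'M[R]_n) v w : R := (v *m g *m w^T) 0 0.

Definition inner_product (g : 'M[R]_n) : Prop :=
  g^T = g /\ forall v, v != 0 -> 0 < bilin g v v.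

(* An orientation is a boolean, false being that of f^0 /\ ... /\ f^(n-1). *)
Definition vol_form (g : 'M[R]_n) (o : bool) : extform R n :=
  ((-1) ^+ o * Num.sqrt (\det g)) *: mono setT.

(* <f^I, f^J>: the minor of the Gram matrix g^-1 of f^0, ..., f^(n-1) with rows
   I and columns J.  The default value of nth is not used when #|I| = #|J|. *)
Definition mono_dot (g : 'M[R]_n) I J : R :=
  if #|I| == #|J| then
    \det (\matrix_(i < #|I|, j < #|I|)
            invmx g (enum_val i) (nth (enum_val i) (enum J) j))
  else 0.

Definition form_dot (g : 'M[R]_n) a b : R :=
  \sum_(I : {set 'I_n}) \sum_(J : {set 'I_n}) a I * b J * mono_dot g I J.

(* a /\ * b = <a, b> vol, solved for the coefficients of * b; see hodgeP. *)
Definition hodge (g : 'M[R]_n) (o : bool) b : extform R n :=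
  [ffun K : {set 'I_n} => (-1) ^+ inversions (~: K) K * form_dot g (mono (~: K)) b
               * vol_form g o setT].

Lemma form_dot_monol (g : 'M[R]_n) I b :
  form_dot g (mono I) b = \sum_(J : {set 'I_n}) b J * mono_dot g I J.
Proof.
rewrite /form_dot (bigD1 I) //= [X in _ + X]big1 ?addr0 => [|K KI].
  by apply: eq_bigr => J _; rewrite ffunE eqxx mul1r.
by apply: big1 => J _; rewrite ffunE (negbTE KI) !mul0r.
Qed.

Lemma hodgeP (g : 'M[R]_n) o k a b : homog k a -> homog k b ->
  wedge a (hodge g o b) = form_dot g a b *: vol_form g o.
Proof.
move=> ha hb; apply/ffunP => K; rewrite !ffunE.
have dot0 I : #|I| != k -> form_dot g (mono I) b = 0.
  move=> kI; rewrite form_dot_monol big1 // => J _; rewrite /mono_dot.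
  by case: eqP => [IJ|_]; rewrite ?mulr0 // hb -?IJ ?mul0r.
have [->|KT] := eqVneq K setT; last first.
  rewrite !scaler0; apply: big1 => I IK; rewrite ffunE.
  have [kI|kI] := eqVneq #|I| k; last by rewrite ha // mulr0 mul0r.
  rewrite dot0 ?mulr0 ?mul0r ?mulr0 //.
  apply: contra KT => /eqP e; rewrite eqEcard subsetT /= cardsT card_ord.
  rewrite -[leqRHS](cardsID I) (setIidPr IK) kI addnC.
  by have := cardsC (K :\: I); rewrite e card_ord => ->.
have -> : form_dot g a b = \sum_(I : {set 'I_n}) a I * form_dot g (mono I) b.
  apply: eq_bigr => I _; rewrite form_dot_monol mulr_sumr.
  by apply: eq_bigr => J _; rewrite mulrA.
rewrite scaler_suml; apply: eq_big => [I|I _]; first by rewrite subsetT.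
rewrite !ffunE setTD setCK eqxx.
have sgnK m (x y z : R) : (-1) ^+ m * x * ((-1) ^+ m * y * z) = x * y * z.
  by rewrite -!mulrA mulrCA (mulrA ((-1) ^+ m) ((-1) ^+ m)) -expr2 sqrr_sign mul1r.
exact: sgnK.
Qed.

Lemma wedgef0 a : wedge a (mono set0) = a.
Proof.
apply/ffunP => K; rewrite ffunE (bigD1 K) //= [X in _ + X]big1.
  rewrite addr0 setDv ffunE eqxx mulr1 /inversions.
  rewrite (_ : [set p in _ | _] = set0) ?cards0 ?expr0 ?mul1r //.
  by apply/setP => p; rewrite !inE andbF.
move=> I /andP[IK IneK]; rewrite ffunE setD_eq0 (_ : K \subset I = false) ?mulr0 //.
by apply/negP => KI; rewrite eqEsubset IK KI in IneK.
Qed.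

Lemma ce_diff_covec br (k : 'I_n) : ce_diff br (covec k) = ce_covec br k.
Proof.
rewrite /ce_diff (bigD1 [set k]) //= [X in _ + X]big1 ?addr0 => [|I kI].
  rewrite big_set1 setDv wedgef0 ffunE eqxx scale1r /inversions.
  rewrite (_ : [set p in _ | _] = set0) ?cards0 ?expr0 ?scale1r //.
  by apply/setP => p; rewrite !inE andbF.
by rewrite ffunE (negbTE kI) scale0r.
Qed.

End ExteriorAlgebra.

Arguments mono {R n} I.
Arguments covec {R n} i.

Notation "a '\w' b" := (wedge a b) (at level 40, left associativity) : ring_scope.

Section G2.
Variable R : realType.
Implicit Types (phi : extform R 7) (g : 'M[R]_7).

Definition g2_structure phi : Prop :=
  homog 3 phi /\
  forall v : 'rV[R]_7, v != 0 ->
    contract v phi \w contract v phi \w phi != 0.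

Definition g2_data_spec phi (go : 'M[R]_7 * bool) : Prop :=
  inner_product go.1 /\
  forall v w : 'rV[R]_7,
    bilin go.1 v w *: vol_form go.1 go.2 =
    6^-1 *: (contract v phi \w contract w phi \w phi).

(* xget picks the pair satisfying the specification; see g2_data_unique. *)
Definition g2_data phi : 'M[R]_7 * bool :=
  classical_sets.xget (0, false) (g2_data_spec phi).

Definition g2_metric phi : 'M[R]_7 := (g2_data phi).1.

Definition g2_hodge phi : extform R 7 -> extform R 7 :=
  hodge (g2_data phi).1 (g2_data phi).2.

Definition purely_coclosed (br : 'rV[R]_7 -> 'rV[R]_7 -> 'rV[R]_7) phi : Prop :=
  ce_diff br (g2_hodge phi phi) = 0 /\ ce_diff br phi \w phi = 0.

Lemma g2_data_unique phi p q : g2_structure phi ->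
  g2_data_spec phi p -> g2_data_spec phi q -> p = q.
Proof.
case: p q => [g o] [h u] [_ phi_neq0] gphi hphi.
have detP (k : 'M[R]_7) s : g2_data_spec phi (k, s) -> 0 < \det k.
  case=> /= _ kP; rewrite ltNge; apply/negP => k_le0.
  pose v : 'rV[R]_7 := delta_mx 0 0.
  have v_neq0 : v != 0.
    by apply/eqP => /rowP/(_ 0)/eqP; rewrite !mxE eqxx oner_eq0.
  have /negP := phi_neq0 v v_neq0; apply; apply/eqP.
  have := kP v v; rewrite /vol_form ler0_sqrtr // mulr0 scale0r scaler0.
  by move/esym/eqP; rewrite scaler_eq0 invr_eq0 pnatr_eq0 /= => /eqP.
have detg := detP _ _ gphi; have deth := detP _ _ hphi.
case: gphi hphi => -[/= _ g_gt0] gP [[/= _ h_gt0] hP].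
pose c : R := (-1) ^+ o * Num.sqrt (\det g).
pose d : R := (-1) ^+ u * Num.sqrt (\det h).
have c2 : c ^+ 2 = \det g by rewrite exprMn sqrr_sign mul1r sqr_sqrtr // ltW.
have d2 : d ^+ 2 = \det h by rewrite exprMn sqrr_sign mul1r sqr_sqrtr // ltW.
have c_neq0 : c != 0 by rewrite -sqrf_eq0 c2 gt_eqF.
have d_neq0 : d != 0 by rewrite -sqrf_eq0 d2 gt_eqF.
have ghv v w : bilin g v w * c = bilin h v w * d.
  have /ffunP/(_ setT) := etrans (gP v w) (esym (hP v w)).
  by rewrite /= !ffunE eqxx -![_ *: _]/(_ * _ : R) !mulr1.
have bilinE (k : 'M[R]_7) i j : bilin k (delta_mx 0 i) (delta_mx 0 j) = k i j.
  by rewrite /bilin -rowE trmx_delta -colE !mxE.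
have gh : g = (d / c) *: h.
  apply/matrixP => i j; have := ghv (delta_mx 0 i) (delta_mx 0 j).
  by rewrite !bilinE !mxE => /(canRL (mulfK c_neq0)) ->; field.
have t_gt0 : 0 < d / c.
  have v_neq0 : delta_mx 0 0 != 0 :> 'rV[R]_7.
    by apply/eqP => /rowP/(_ 0)/eqP; rewrite !mxE eqxx oner_eq0.
  have := g_gt0 _ v_neq0; have := h_gt0 _ v_neq0.
  by rewrite !bilinE [in g _ _]gh mxE => h0; rewrite pmulr_lgt0.
have t1 : (d / c) ^+ 9 = 1.
  have := c2; rewrite gh detZ -d2 => e.
  rewrite (exprD _ 7 2) [in X in _ * X]expr_div_n mulrA -e.
  by rewrite mulfV // sqrf_eq0.
have cd : d = c.
  have /eqP := t1; rewrite pexpr_eq1 // ?ltW // => /eqP/(canRL (mulfVK c_neq0)).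
  by rewrite mul1r.
move: gh; rewrite cd mulfV // scale1r => gh; rewrite -gh in cd *; congr (_, _).
move: c_neq0 cd; rewrite /c /d -gh mulf_eq0 negb_or => /andP[_ s_neq0].
by move=> /(mulIf s_neq0)/signr_inj.
Qed.

End G2.

(* The basis of R^7 is numbered from 1 to 7 in what follows. *)
Definition idx (k : nat) : 'I_7 := inord k.-1.

Section N62R.
Variable R : realType.

Definition n62R (x y : 'rV[R]_7) : 'rV[R]_7 :=
  - (x 0 (idx 1) * y 0 (idx 2) - x 0 (idx 2) * y 0 (idx 1)) *:
      delta_mx 0 (idx 5)
  - (x 0 (idx 1) * y 0 (idx 4) - x 0 (idx 4) * y 0 (idx 1) +
     (x 0 (idx 2) * y 0 (idx 3) - x 0 (idx 3) * y 0 (idx 2))) *: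
      delta_mx 0 (idx 6).

Lemma n62R_lie : lie_bracket n62R.
Proof.
have n62E x y a : a \in iota 1 4 -> n62R x y 0 (idx a) = 0.
  rewrite !inE => /or4P[] /eqP->; rewrite !mxE -!val_eqE /= !inordK //=;
    by rewrite !mulr0 subr0.
have n620 x y z : n62R x (n62R y z) = 0.
  by rewrite {1}/n62R !n62E // !(mulr0, mul0r, subr0, addr0, scale0r, oppr0).
split.
- move=> c x y z; apply/rowP => j; rewrite !mxE; ring.
- move=> x; apply/rowP => j; rewrite !mxE; ring.
- move=> x y; apply/rowP => j; rewrite !mxE; ring.
- by move=> x y z; rewrite !n620 !addr0.
Qed.

(* The tuple (0, 0, 0, 0, f^12, f^14 + f^23, 0). *)
Lemma n62R_dE :
  let f k : extform R 7 := covec (idx k) in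
  map (fun k => ce_diff n62R (f k)) (iota 1 7) =
  [:: 0; 0; 0; 0; f 1%N \w f 2%N; f 1%N \w f 4%N + f 2%N \w f 3%N; 0].
Proof.
rewrite /=.
have E (F : 'I_7 -> 'I_7 -> extform R 7) : (forall i j, (i, j) \notin
   [:: (idx 1, idx 2); (idx 1, idx 4); (idx 2, idx 3)] -> (i < j)%N -> F i j = 0) ->
   \sum_(i < 7) \sum_(j < 7 | (i < j)%N) F i j =
   F (idx 1) (idx 2) + F (idx 1) (idx 4) + F (idx 2) (idx 3).
  move=> F0; rewrite pair_big_dep /=.
  rewrite (bigD1 (idx 1, idx 2)) /=; last by rewrite !inordK.
  rewrite (bigD1 (idx 1, idx 4)) /=; last first.
    by rewrite !inordK // xpair_eqE -!val_eqE /= !inordK.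
  rewrite (bigD1 (idx 2, idx 3)) /=; last first.
    by rewrite !inordK // !xpair_eqE -!val_eqE /= !inordK.
  rewrite big1 ?addr0 ?addrA // => -[i j] /= /andP[/andP[/andP[ij h1] h2] h3].
  by apply: F0 => //; rewrite !inE !negb_or h1 h2 h3.
have Z k (i j : 'I_7) :
    (i, j) \notin [:: (idx 1, idx 2); (idx 1, idx 4); (idx 2, idx 3)] ->
    (i < j)%N -> - n62R (delta_mx 0 i) (delta_mx 0 j) 0 k *:
                 (covec i \w covec j) = 0 :> extform R 7.
  rewrite !inE !xpair_eqE -!val_eqE /= !inordK // => ij i_lt_j.
  rewrite (_ : n62R _ _ = 0) ?mxE ?oppr0 ?scale0r ?scaler0 //.
  rewrite /n62R !mxE -!val_eqE /= !inordK //.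
  case: i j ij i_lt_j => [[|[|[|[|[|[|[|//]]]]]]] li] [[|[|[|[|[|[|[|//]]]]]]] lj] //= _ _;
    by rewrite !(mulr0, mul0r, subr0, addr0, scale0r, oppr0).
rewrite /= !ce_diff_covec /ce_covec !E; try exact: Z.
rewrite !mxE -!val_eqE /= !inordK //=.
by rewrite !(mulr0, mul0r, mulr1, subr0, sub0r, add0r, addr0, scale0r, oppr0, opprK, scale1r).
Qed.

(* Gram matrix of f^i (.) f^j = (f^i (x) f^j + f^j (x) f^i) / 2. *)
Definition odot (i j : nat) : 'M[R]_7 :=
  2^-1 *: (delta_mx (idx i) (idx j) + delta_mx (idx j) (idx i)).

Definition n62R_metric (r E F G : R) : 'M[R]_7 :=
  odot 1 1 + odot 2 2 + odot 3 3 + r *: odot 4 4 + E *: odot 5 5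
  + (2 * F) *: odot 5 6 + G *: odot 6 6 + odot 7 7.

End N62R.

(* Main.v *)
(* Write W for the span of f1, ..., f4.  The components of d * phi = 0 along f5
   and f6 force phi to vanish on W, so phi = f5 X + f6 Y + f7 Z + (terms of higher
   degree in f5, f6, f7) with X, Y, Z in Lambda^2 W.  Let A and B be the 3 x 3 matrices of self-dual
   and anti-self-dual coefficients of (X, Y, Z).  The W-block of g_phi = g says
   adj A * B = A^T (adj B)^T and det A <> det B, hence A = 0 or B = 0; both cases
   are X = x1 (f12 + u f34) + x2 (f13 - u f24) + x3 (u f14 + f23), and likewise for
   Y and Z, with u = sqrt r or u = - sqrt r.  The mixed block of the metric then kills
   the terms of degree 2 in f5, f6, f7, and the last block says that the Gram
   matrix of (X, Y, Z) is proportional to that of (f5, f6, f7).  Together with the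
   remaining equations of d * phi = 0 and d phi /\ phi = 0 this yields F = 0 and
   G (1 + u)^2 = E r; conversely such u gives an explicit phi. *)
Require Import Defs.
From mathcomp Require Import all_boot all_order all_algebra reals ring lra.
From mathcomp Require classical_sets boolp.

Set Implicit Arguments.
Unset Strict Implicit.
Unset Printing Implicit Defensive.

Import Order.TTheory GRing.Theory Num.Theory.
Local Open Scope ring_scope.

(** * Linearity of the operations on forms, and their values on monomials *)

Section SparseForms.
Variables (R : realType) (n : nat).
Implicit Types (a b : extform R n) (I J K : {set 'I_n}) (s t : seq nat).

Lemma extform_scaleE (c : R) a K : (c *: a) K = c * a K.
Proof. by rewrite ffunE. Qed.

Lemma wedge0l b : wedge 0 b = 0.
Proof. by apply/ffunP => K; rewrite !ffunE big1 // => I _; rewrite ffunE mulr0 mul0r. Qed.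

Lemma wedgeDl a a' b : wedge (a + a') b = wedge a b + wedge a' b.
Proof.
apply/ffunP => K; rewrite !ffunE -big_split; apply: eq_bigr => I _ /=.
by rewrite ffunE mulrDr mulrDl.
Qed.

Lemma wedgeZl (c : R) a b : wedge (c *: a) b = c *: wedge a b.
Proof.
apply/ffunP => K; rewrite extform_scaleE !ffunE mulr_sumr.
apply: eq_bigr => I _ /=; rewrite extform_scaleE.
by rewrite mulrCA -!mulrA.
Qed.

Lemma wedge0r a : wedge a 0 = 0.
Proof. by apply/ffunP => K; rewrite !ffunE big1 // => I _; rewrite ffunE mulr0. Qed.

Lemma wedgeDr a b b' : wedge a (b + b') = wedge a b + wedge a b'.
Proof.
apply/ffunP => K; rewrite !ffunE -big_split; apply: eq_bigr => I _ /=.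
by rewrite ffunE mulrDr.
Qed.

Lemma wedgeZr (c : R) a b : wedge a (c *: b) = c *: wedge a b.
Proof.
apply/ffunP => K; rewrite extform_scaleE !ffunE mulr_sumr.
apply: eq_bigr => I _ /=; rewrite extform_scaleE.
by rewrite mulrCA -!mulrA.
Qed.

Lemma wedge_suml (T : Type) (l : seq T) (F : T -> extform R n) b :
  wedge (\sum_(t <- l) F t) b = \sum_(t <- l) wedge (F t) b.
Proof.
by apply: (big_morph (fun a => wedge a b)) => [a a'|]; rewrite (wedgeDl, wedge0l).
Qed.

Lemma wedge_sumr (T : Type) (l : seq T) a (F : T -> extform R n) :
  wedge a (\sum_(t <- l) F t) = \sum_(t <- l) wedge a (F t).
Proof. by apply: (big_morph (wedge a)) => [b b'|]; rewrite (wedgeDr, wedge0r). Qed.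

Lemma wedge_mono I J : wedge (mono I) (mono J) =
  if [disjoint I & J] then (-1) ^+ inversions I J *: mono (I :|: J)
  else 0 :> extform R n.
Proof.
apply/ffunP => K; rewrite ffunE.
have [dIJ|ndIJ] := boolP [disjoint I & J]; last first.
  rewrite ffunE big1 // => L LK; rewrite !ffunE.
  have [->|] := eqVneq L I; last by rewrite mulr0 mul0r.
  case: eqVneq => [e|]; rewrite ?mulr0 //; case/negP: ndIJ.
  by rewrite -e disjoint_sym disjoints_subset setDE subsetIr.
rewrite extform_scaleE !ffunE; have [->|KIJ] := eqVneq K (I :|: J).
  rewrite (bigD1 I) ?subsetUl //= big1 ?addr0 => [|L /andP[_ /negbTE LI]].
    have -> : (I :|: J) :\: I = J.
      by rewrite setDUl setDv set0U; apply/setDidPl; rewrite disjoint_sym.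
    by rewrite !ffunE !eqxx !mulr1.
  by rewrite !ffunE LI mulr0 mul0r.
rewrite mulr0 big1 // => L LK; rewrite !ffunE.
have [LI|] := eqVneq L I; last by rewrite mulr0 mul0r.
case: eqVneq => [e|]; rewrite ?mulr0 //; case/eqP: KIJ.
by rewrite -e -LI -[LHS](setID K L) (setIidPr LK).
Qed.

Lemma contract0 v : contract v 0 = 0 :> extform R n.
Proof. by apply/ffunP => K; rewrite !ffunE big1 // => I _; rewrite ffunE mulr0. Qed.

Lemma contractD v a b : contract v (a + b) = contract v a + contract v b.
Proof.
apply/ffunP => K; rewrite !ffunE -big_split; apply: eq_bigr => I _ /=.
by rewrite ffunE mulrDr.
Qed.

Lemma contractZ v (c : R) a : contract v (c *: a) = c *: contract v a.
Proof.
apply/ffunP => K; rewrite extform_scaleE !ffunE mulr_sumr.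
apply: eq_bigr => I _ /=; rewrite extform_scaleE.
by rewrite mulrCA -!mulrA.
Qed.

Lemma contract_sum v (T : Type) (l : seq T) (F : T -> extform R n) :
  contract v (\sum_(t <- l) F t) = \sum_(t <- l) contract v (F t).
Proof. by apply: (big_morph (contract v)) => [b b'|]; rewrite (contractD, contract0). Qed.

(** Serves to reduce contractions to basis vectors, where [contract_mono] applies. *)
Lemma contract_suml (v : 'rV[R]_n) a :
  contract v a = \sum_(i < n) v 0 i *: contract (delta_mx 0 i) a.
Proof.
apply/ffunP => K; rewrite ffunE sum_ffunE [LHS]big_mkcond; apply: eq_bigr => i _ /=.
rewrite extform_scaleE !ffunE; case: ifPn => iK.
  rewrite (bigD1 i) //= big1 ?addr0 => [|j /andP[_ ji]].
    by rewrite mxE !eqxx /= mulr1 mulrCA mulrA.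
  by rewrite mxE (negbTE ji) /= mulr0 mul0r.
rewrite big1 ?mulr0 // => j jK; rewrite mxE andTb.
case: (eqVneq j i) => [ji|_]; last by rewrite mulr0 mul0r.
by rewrite -ji jK in iK.
Qed.

Lemma contract_mono (k : 'I_n) I :
  contract (delta_mx 0 k) (mono I) =
  if k \in I then (-1) ^+ inversions [set k] (I :\ k) *: mono (I :\ k)
  else 0 :> extform R n.
Proof.
apply/ffunP => K; rewrite ffunE.
have Ek i (x : R) : i != k -> (delta_mx 0 k : 'rV[R]_n) 0 i * x = 0.
  by rewrite mxE => /negbTE->; rewrite mul0r.
have [kI|kI] := boolP (k \in I); last first.
  rewrite ffunE big1 // => i iK; have [->|/Ek] := eqVneq i k; last first.
    by move=> H; rewrite -mulrA H mulr0.
  rewrite ffunE; case: eqP => [e|]; rewrite ?mulr0 //.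
  by rewrite -e setU11 in kI.
rewrite extform_scaleE !ffunE; have [->|KI] := eqVneq K (I :\ k).
  rewrite (bigD1 k) ?setD11 //= big1 => [|i /andP[_ /Ek H]]; last by rewrite -mulrA H mulr0.
  by rewrite ffunE setD1K // eqxx mxE !eqxx !mulr1 addr0.
rewrite mulr0 big1 // => i iK; have [ik|/Ek H] := eqVneq i k; last by rewrite -mulrA H mulr0.
rewrite ffunE; case: eqP => [e|]; rewrite ?mulr0 //; case/eqP: KI.
by rewrite -e ik setU1K // -ik.
Qed.

Lemma ce_diff_sum br (T : Type) (l : seq T) (F : T -> extform R n) :
  ce_diff br (\sum_(t <- l) F t) = \sum_(t <- l) ce_diff br (F t).
Proof.
apply: (big_morph (ce_diff br)) => [a b|].
  by rewrite /ce_diff -big_split; apply: eq_bigr => I _; rewrite ffunE scalerDl.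
by rewrite /ce_diff big1 // => I _; rewrite ffunE scale0r.
Qed.

Lemma ce_diffZ br (c : R) a : ce_diff br (c *: a) = c *: ce_diff br a.
Proof.
rewrite /ce_diff scaler_sumr; apply: eq_bigr => I _.
by rewrite ffunE scalerA.
Qed.

Lemma ce_diff_mono br I : ce_diff br (mono I) =
  \sum_(i in I) (-1) ^+ inversions [set i] (I :\ i) *:
      wedge (ce_covec br i) (mono (I :\ i)) :> extform R n.
Proof.
rewrite /ce_diff (bigD1 I) //= [X in _ + X]big1 ?addr0 => [|J /negbTE JI].
  by rewrite ffunE eqxx scale1r.
by rewrite ffunE JI scale0r.
Qed.

(** * Index sets as lists of natural numbers *)

Definition supp s : {set 'I_n} := [set i | val i \in s].

(** Lists are used because they evaluate under [vm_compute]. Order and repetitions in [s] are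
    immaterial: this normal form is what decides equality of supports and counts inversions. *)
Definition canon s := [seq i <- iota 0 n | i \in s].

Lemma enum_supp s : map val (enum (supp s)) = canon s.
Proof.
rewrite /canon -val_enum_ord filter_map {1}/enum_mem -enumT /=.
congr (map _ _); apply: eq_filter => i; by rewrite !inE.
Qed.

Lemma supp_inj s t : (supp s == supp t) = (canon s == canon t).
Proof.
apply/eqP/eqP => [e|e]; first by rewrite -!enum_supp e.
apply/setP => i; rewrite !inE.
have : (val i \in canon s) = (val i \in canon t) by rewrite e.
by rewrite !mem_filter !mem_iota /= add0n ltn_ord !andbT.
Qed.

Lemma supp_canon s : supp (canon s) = supp s.
Proof. by apply/setP => i; rewrite !inE mem_filter mem_iota /= ltn_ord andbT. Qed.

Lemma canonK s : canon (canon s) = canon s.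
Proof. by apply/eqP; rewrite -supp_inj supp_canon. Qed.

Definition disj s t := ~~ has (mem t) (canon s).

Lemma disj_supp s t : [disjoint supp s & supp t] = disj s t.
Proof.
apply/pred0P/hasPn => /= [H i|H i].
  rewrite mem_filter mem_iota add0n /= => /andP[si ni].
  by have := H (Ordinal ni); rewrite /= !inE /= si /= => /negbT.
rewrite !inE; apply/andP => -[si ti].
have : val i \in canon s by rewrite mem_filter si mem_iota add0n /=.
by move=> /H /negP; apply.
Qed.

Definition inv s t :=
  sumn [seq count (fun j => j < i)%N (canon t) | i <- canon s].

Lemma inversions_supp s t : inversions (supp s) (supp t) = inv s t.
Proof.
rewrite /inversions -sum1_card big_mkcond /=.
rewrite (eq_bigr (fun p => if p.1 \in supp s then
    if (p.2 \in supp t) && (p.2 < p.1)%N then 1 else 0 else 0)%N); last first.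
  by move=> p _; rewrite !inE; case: (_ \in s) => //=.
rewrite -(pair_bigA _ (fun i j => if i \in supp s then
    if (j \in supp t) && (j < i)%N then 1 else 0 else 0)%N) /=.
rewrite /inv -(enum_supp s) -map_comp sumnE big_map big_enum /= [RHS]big_mkcond /=.
apply: eq_bigr => i _; case: ifP => _; last by rewrite big1.
rewrite -enum_supp count_map -sum1_count big_enum_cond /= -big_mkcond /=.
by apply: eq_bigl => j.
Qed.

Lemma supp_cat s t : supp (s ++ t) = supp s :|: supp t.
Proof. by apply/setP => i; rewrite !inE mem_cat. Qed.

Lemma supp_iota : supp (iota 0 n) = setT.
Proof. by apply/setP => i; rewrite !inE mem_iota /= ltn_ord. Qed.

Lemma setC_supp s : ~: supp s = supp [seq i <- iota 0 n | i \notin s].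
Proof. by apply/setP => i; rewrite !inE mem_filter mem_iota /= ltn_ord andbT. Qed.

Lemma card_supp s : #|supp s| = size (canon s).
Proof. by rewrite -enum_supp size_map cardE. Qed.

End SparseForms.

(* ((b, vs), s) stands for the form (-1)^b * (product of the coefficients indexed
   by vs) * f^s. *)
Definition term : Type := (bool * seq nat) * seq nat.

(** * Symbolic exterior algebra on lists of terms *)

Section TermLists.
Variable n : nat.
Implicit Types (s : seq nat) (t : term) (l : seq term).

Definition wedge_term t1 t2 : term :=
  ((t1.1.1 (+) t2.1.1 (+) odd (inv n t1.2 t2.2), t1.1.2 ++ t2.1.2), t1.2 ++ t2.2).

Definition wedge_terms l1 l2 : seq term :=
  flatten [seq [seq wedge_term t1 t2 | t2 <- l2 & disj n t1.2 t2.2] | t1 <- l1].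

Definition contract_term (k : nat) t : term :=
  let s := filter (predC1 k) t.2 in
  ((t.1.1 (+) odd (inv n [:: k] s), t.1.2), s).

Definition contract_terms (k : nat) l : seq term :=
  [seq contract_term k t | t <- l & k \in t.2].

(** The Leibniz rule of [ce_diff] and the contraction by a basis vector carry the same sign, so
    [contract_term] serves for both. [D k] lists the terms of the differential of the basis covector
    numbered [k] from 0. *)
Definition diff_terms (D : nat -> seq term) l : seq term :=
  flatten [seq flatten [seq wedge_terms (D k) [:: contract_term k t]
                       | k <- canon n t.2] | t <- l].

Definition coefs l s : seq (bool * seq nat) :=
  [seq t.1 | t <- l & canon n t.2 == canon n s].

(** Masks beginning with [true] come first, which puts [ksubsets] in lexicographic order. *)
Fixpoint bitseqs (m : nat) : seq bitseq :=
  if m is m'.+1 then map (cons true) (bitseqs m') ++ map (cons false) (bitseqs m')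
  else [:: [::]].

Definition ksubsets (k : nat) : seq (seq nat) :=
  [seq s <- [seq mask m (iota 0 n) | m <- bitseqs n] | size s == k].

(** The generic form of degree [k]: one variable for each monomial. *)
Definition basis_terms k : seq term :=
  [seq ((false, [:: j]), nth [::] (ksubsets k) j) | j <- iota 0 (size (ksubsets k))].

End TermLists.

Lemma mem_bitseqs m (b : bitseq) : size b = m -> b \in bitseqs m.
Proof.
elim: m b => [|m IH] [|c b] //= [/IH bm].
by rewrite mem_cat; case: c; rewrite map_f ?orbT.
Qed.

Lemma bitseqs_uniq m : uniq (bitseqs m).
Proof.
elim: m => //= m IH; rewrite cat_uniq !map_inj_uniq ?IH //=; try by move=> x y [].
by rewrite andbT; apply/hasPn => _ /mapP[x _ ->]; apply/mapP => -[].
Qed.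

(** * Interpretation of terms under an assignment [e] of the variables *)

Section Forms.
Variables (R : realType) (n : nat) (e : nat -> R).
Implicit Types (s : seq nat) (t : term) (l : seq term).

Definition coef_val (m : bool * seq nat) : R :=
  let p := \prod_(k <- m.2) e k in if m.1 then - p else p.

Lemma coef_valE m : coef_val m = (-1) ^+ m.1 * \prod_(k <- m.2) e k.
Proof. by rewrite /coef_val; case: m.1; rewrite ?mulN1r ?mul1r. Qed.

Definition form_of l : extform R n :=
  \sum_(t <- l) coef_val t.1 *: mono (supp n t.2).

Lemma form_of_cat l1 l2 : form_of (l1 ++ l2) = form_of l1 + form_of l2.
Proof. by rewrite /form_of big_cat. Qed.

Lemma form_of_flatten (T : Type) (F : T -> seq term) (l : seq T) :
  form_of (flatten [seq F x | x <- l]) = \sum_(x <- l) form_of (F x).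
Proof. by rewrite /form_of big_flatten big_map. Qed.

Lemma wedge_form_of l1 l2 :
  form_of l1 \w form_of l2 = form_of (wedge_terms n l1 l2).
Proof.
rewrite form_of_flatten wedge_suml; apply: eq_bigr => t1 _.
rewrite wedgeZl wedge_sumr /form_of big_map big_filter [RHS]big_mkcond scaler_sumr.
apply: eq_bigr => t2 _; rewrite wedgeZr wedge_mono disj_supp; case: ifP => _.
  rewrite /= supp_cat !scalerA; congr (_ *: _); rewrite !coef_valE /= inversions_supp.
  rewrite big_cat /= !signr_addb signr_odd; ring.
by rewrite !scaler0.
Qed.

Lemma supp1 (k : 'I_n) : supp n [:: val k] = [set k].
Proof. by apply/setP => i; rewrite !inE -val_eqE. Qed.

Lemma supp_rem (k : 'I_n) s : supp n (filter (predC1 (val k)) s) = supp n s :\ k.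
Proof. by apply/setP => i; rewrite !inE mem_filter /= -val_eqE. Qed.

Lemma contract_term_form (k : 'I_n) t :
  coef_val (contract_term n k t).1 *: mono (supp n (contract_term n k t).2) =
  coef_val t.1 *: ((-1) ^+ inversions [set k] (supp n t.2 :\ k) *: mono (supp n t.2 :\ k))
  :> extform R n.
Proof.
rewrite /= supp_rem scalerA !coef_valE /= -inversions_supp supp1 supp_rem.
by rewrite signr_addb signr_odd mulrAC.
Qed.

Lemma contract_form_of (k : 'I_n) l :
  contract (delta_mx 0 k) (form_of l) = form_of (contract_terms n k l).
Proof.
rewrite contract_sum /form_of big_map big_filter [RHS]big_mkcond.
apply: eq_bigr => t _; rewrite contractZ contract_mono inE.
by case: ifP => _; rewrite ?scaler0 // contract_term_form.
Qed.

Lemma ce_diff_form_of br (D : nat -> seq term) l :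
    (forall k : 'I_n, ce_covec br k = form_of (D k)) ->
  ce_diff br (form_of l) = form_of (diff_terms n D l).
Proof.
move=> HD; rewrite ce_diff_sum form_of_flatten; apply: eq_bigr => t _.
rewrite ce_diffZ ce_diff_mono form_of_flatten -enum_supp big_map big_enum /=.
rewrite scaler_sumr; apply: eq_bigr => k _.
rewrite -wedge_form_of -HD /form_of big_seq1 contract_term_form !wedgeZr.
by rewrite !scalerA.
Qed.

Lemma form_ofE l s :
  form_of l (supp n s) = \sum_(m <- coefs n l s) coef_val m.
Proof.
rewrite /form_of sum_ffunE big_map big_filter [RHS]big_mkcond.
apply: eq_bigr => t _; rewrite extform_scaleE ffunE supp_inj eq_sym.
by case: ifP; rewrite ?mulr1 ?mulr0.
Qed.

Lemma mem_ksubsets (I : {set 'I_n}) :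
  exists2 s, s \in ksubsets n #|I| & I = supp n s.
Proof.
have IE : I = supp n (map val (enum I)).
  by apply/setP => i; rewrite inE mem_map ?mem_enum //; apply: val_inj.
exists (map val (enum I)) => //.
rewrite mem_filter size_map -cardE eqxx /= {1}IE enum_supp.
rewrite /canon filter_mask; apply/map_f/mem_bitseqs.
by rewrite size_map size_iota.
Qed.

Lemma canon_mask (b : bitseq) : canon n (mask b (iota 0 n)) = mask b (iota 0 n).
Proof.
apply: (irr_sorted_eq ltn_trans ltnn).
- by apply: sorted_filter (iota_ltn_sorted 0 n); apply: ltn_trans.
- by apply: sorted_mask (iota_ltn_sorted 0 n); apply: ltn_trans.
by move=> i; rewrite mem_filter andb_idr // => /mem_mask.
Qed.

Lemma ksubsets_canon k s : s \in ksubsets n k -> size s = k /\ canon n s = s.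
Proof. by rewrite mem_filter => /andP[/eqP-> /mapP[b _ ->]]; rewrite canon_mask. Qed.

Lemma uniq_ksubsets k : uniq [seq supp n s | s <- ksubsets n k].
Proof.
rewrite map_inj_in_uniq.
  rewrite filter_uniq // map_inj_in_uniq ?bitseqs_uniq // => b c.
  have sz (m : nat) (d : bitseq) : d \in bitseqs m -> size d = m.
    elim: m d => [|m IH] d /=; first by rewrite inE => /eqP->.
    by rewrite mem_cat => /orP[] /mapP[x /IH <- ->].
  move=> /sz bn /sz cn bc.
  (* A mask is recovered from the set it selects by testing the membership of each index. *)
  have H (d : bitseq) : size d = n ->
      map (fun i => i \in mask d (iota 0 n)) (iota 0 n) = d.
    move=> dn; apply: (@eq_from_nth _ false); first by rewrite size_map size_iota.
    move=> i; rewrite size_map size_iota => i_n.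
    rewrite (nth_map 0%N) ?size_iota // in_mask ?iota_uniq //.
    by rewrite mem_nth ?size_iota // index_uniq ?iota_uniq ?size_iota.
  by rewrite -(H b) // -(H c) // bc.
move=> s t; rewrite !mem_filter => /andP[_ /mapP[b _ ->]] /andP[_ /mapP[c _ ->]].
by move/eqP; rewrite supp_inj !canon_mask => /eqP.
Qed.

End Forms.

(** The monomials of degree [k] are a basis, so every symbolic computation on [basis_terms] applies
    to any form of degree [k], with its own coefficients as assignment. *)
Lemma homog_form_of (R : realType) (n k : nat) (a : extform R n) : homog k a ->
  a = form_of n (fun j => a (supp n (nth [::] (ksubsets n k) j))) (basis_terms n k).
Proof.
move=> hk; rewrite /form_of /basis_terms big_map /=.
under eq_bigr do rewrite /coef_val /= big_seq1.
set L := ksubsets n k.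
have -> : \sum_(j <- iota 0 (size L)) a (supp n (nth [::] L j)) *:
    mono (supp n (nth [::] L j)) =
  \sum_(I <- [seq supp n s | s <- L]) a I *: mono I.
  by rewrite big_map [RHS](big_nth [::]) /index_iota subn0.
apply/ffunP => K; rewrite sum_ffunE.
have [Kk|Kk] := eqVneq #|K| k; last first.
  rewrite hk // big1 // => I _; rewrite extform_scaleE ffunE.
  by case: eqVneq => [<-|_]; rewrite ?mulr0 // hk ?mul0r.
have KL : K \in [seq supp n s | s <- L].
  by have [s] := mem_ksubsets K; rewrite Kk => sL ->; apply: map_f.
rewrite (bigD1_seq K) ?uniq_ksubsets //= big1 => [|I /negbTE IK].
  by rewrite extform_scaleE ffunE eqxx mulr1 addr0.
by rewrite extform_scaleE ffunE eq_sym IK mulr0.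
Qed.

(** * Vanishing of symbolic forms, and minors of size 3 *)

Section MoreForms.
Variables (R : realType) (n : nat).
Implicit Types (e : nat -> R) (l : seq term) (s : seq nat).

Lemma form_of_top e l : all (fun t => canon n t.2 == iota 0 n) l ->
  form_of n e l = (\sum_(t <- l) coef_val e t.1) *: mono setT.
Proof.
move=> /allP H; rewrite /form_of scaler_suml big_seq [RHS]big_seq.
apply: eq_bigr => t /H; rewrite -supp_canon => /eqP->.
by rewrite supp_iota.
Qed.

(** An index set absent from the list has an empty sum as coefficient, so only the index sets that
    occur need to be tested. *)
Lemma form_of_eq0 e l : form_of n e l = 0 <->
  {in [seq canon n t.2 | t <- l], forall s, \sum_(m <- coefs n l s) coef_val e m = 0}.
Proof.
split=> [l0 s _|l0]; first by rewrite -form_ofE l0 ffunE.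
apply/ffunP => K; have [s sK ->] := mem_ksubsets K.
rewrite form_ofE ffunE; have [/l0|sl] := boolP (canon n s \in [seq canon n t.2 | t <- l]).
  by rewrite /coefs canonK.
rewrite /coefs (_ : [seq t <- l | _] = [::]) ?big_nil //.
  apply/eqP; rewrite -[_ == _]negbK -has_filter; apply: contra sl.
  by move=> /hasP[t tl /eqP <-]; apply: (map_f (fun t => canon n t.2)).
Qed.

Lemma det2E (B : 'M[R]_2) : \det B = B 0 0 * B 1 1 - B 0 1 * B 1 0.
Proof.
(* Once entries are read at natural numbers, the ordinals produced by the expansion reduce to
   literals, as [ring] requires. *)
pose f i j := B (inord i) (inord j).
have Bf i j : B i j = f i j by rewrite /f !inord_val.
rewrite (expand_det_row B 0) !big_ord_recl big_ord0 /cofactor !det_mx11 !mxE.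
by rewrite !Bf /= /bump /=; ring.
Qed.

Lemma det3E (A : 'M[R]_3) : \det A =
  A 0 0 * (A 1 1 * A 2 2 - A 1 2 * A 2 1)
  - A 0 1 * (A 1 0 * A 2 2 - A 1 2 * A 2 0)
  + A 0 2 * (A 1 0 * A 2 1 - A 1 1 * A 2 0).
Proof.
pose f i j := A (inord i) (inord j).
have Af i j : A i j = f i j by rewrite /f !inord_val.
rewrite (expand_det_row A 0) !big_ord_recl big_ord0 /cofactor !det2E !mxE.
by rewrite !Af /= /bump /=; ring.
Qed.

Definition det3 (h : nat -> nat -> R) (i j : seq nat) : R :=
  let f a b := h (nth 0%N i a) (nth 0%N j b) in
  f 0%N 0%N * (f 1%N 1%N * f 2%N 2%N - f 1%N 2%N * f 2%N 1%N)
  - f 0%N 1%N * (f 1%N 0%N * f 2%N 2%N - f 1%N 2%N * f 2%N 0%N)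
  + f 0%N 2%N * (f 1%N 0%N * f 2%N 1%N - f 1%N 1%N * f 2%N 0%N).

Lemma mono_dot3 (g : 'M[R]_n) (h : nat -> nat -> R) s t :
    (forall i j : 'I_n, invmx g i j = h i j) ->
    size (canon n s) = 3%N -> size (canon n t) = 3%N ->
  mono_dot g (supp n s) (supp n t) = det3 h (canon n s) (canon n t).
Proof.
move=> gh sz tz; rewrite /mono_dot ifT; last by rewrite !card_supp sz tz.
(* The minor has size [#|supp s|], which equals 3 only propositionally; here the size is
   replaced. *)
have E m (M : 'M[R]_m) (f : nat -> nat -> R) : m = 3%N ->
    (forall i j, M i j = f i j) -> \det M = \det (\matrix_(i < 3, j < 3) f i j).
  move=> m3; rewrite {m}m3 in M * => Mf.
  by congr (\det _); apply/matrixP => i j; rewrite mxE Mf.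
rewrite (E _ _ (fun i j => h (nth 0%N (canon n s) i) (nth 0%N (canon n t) j))).
- by rewrite det3E !mxE.
- by rewrite card_supp.
move=> i j; rewrite mxE gh; congr (h _ _).
  rewrite -enum_supp (nth_map (enum_val i)) -?cardE //.
  by congr val; apply: enum_val_nth.
rewrite -(enum_supp n t) (nth_map (enum_val i)) //.
by apply: leq_trans (ltn_ord j) _; rewrite -cardE !card_supp sz tz.
Qed.
End MoreForms.

(** * The structure equations and the metric in coordinates *)

Definition n62R_terms (k : nat) : seq term :=
  nth [::] [:: [::]; [::]; [::]; [::]; [:: ((false, [::]), [:: 0; 1])];
    [:: ((false, [::]), [:: 0; 3]); ((false, [::]), [:: 1; 2])]; [::]]%N k.

Section N62R.
Variable R : realType.

Lemma idxE k : (k < 7)%N -> val (idx k.+1) = k.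
Proof. by move=> k7; rewrite /idx /= inordK. Qed.

Lemma covec_form_of (e : nat -> R) k : (k < 7)%N ->
  covec (idx k.+1) = form_of 7 e [:: ((false, [::]), [:: k])].
Proof.
move=> k7; rewrite /form_of big_seq1 /coef_val big_nil scale1r.
by rewrite -[in RHS](idxE k7) supp1.
Qed.

(** Indices start from 0 in [n62R_terms], so that its two non-empty entries, 4 and 5, belong to f^5
    and f^6. *)
Lemma ce_covec_n62R (e : nat -> R) (k : 'I_7) :
  ce_covec (@n62R R) k = form_of 7 e (n62R_terms k).
Proof.
have -> : k = idx k.+1 by rewrite /idx inord_val.
have := congr1 (fun l => nth 0 l k) (n62R_dE R).
rewrite (nth_map 0%N) ?size_iota // nth_iota // add1n ce_diff_covec => ->.
rewrite !(covec_form_of e) // !wedge_form_of -form_of_cat idxE //.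
have nil0 : form_of 7 e [::] = 0 by rewrite /form_of big_nil.
by case: k => [[|[|[|[|[|[|[|//]]]]]]] ?]; rewrite /= ?nil0.
Qed.

Definition metric_entry (r E F G : R) (i j : nat) : R :=
  nth 0 (nth [::] [:: [:: 1; 0; 0; 0; 0; 0; 0]; [:: 0; 1; 0; 0; 0; 0; 0];
    [:: 0; 0; 1; 0; 0; 0; 0]; [:: 0; 0; 0; r; 0; 0; 0]; [:: 0; 0; 0; 0; E; F; 0];
    [:: 0; 0; 0; 0; F; G; 0]; [:: 0; 0; 0; 0; 0; 0; 1]] i) j.

Lemma n62R_metricE r E F G :
  n62R_metric r E F G = \matrix_(i, j) metric_entry r E F G i j.
Proof.
apply/matrixP => i j; rewrite /n62R_metric /odot !mxE -!val_eqE /= !inordK //.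
have half (x : R) : 2^-1 * (x + x) = x by field.
have half2 (x : R) : 2 * x * (2^-1 * 1) = x by field.
case: i j => [[|[|[|[|[|[|[|//]]]]]]] ?] [[|[|[|[|[|[|[|//]]]]]]] ?];
  by rewrite /metric_entry /= ?half ?(addr0, add0r, mulr0, half, half2, mulr1).
Qed.

(** The inverse of a block diagonal matrix has blocks of the same shape, the 2 x 2 one being its
    adjugate over D; [metric_entry] therefore describes the inverse too. *)
Lemma metric_entry_inv r E F G : r != 0 -> E * G - F ^+ 2 != 0 ->
  let D := E * G - F ^+ 2 in
  invmx (n62R_metric r E F G) =
  \matrix_(i, j) metric_entry r^-1 (G / D) (- F / D) (E / D) i j.
Proof.
move=> r0 D0 D; set h := \matrix_(i, j) _.
have gh : n62R_metric r E F G *m h = 1%:M.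
  rewrite n62R_metricE; apply/matrixP => i j; rewrite !mxE !big_ord_recl big_ord0 !mxE.
  case: i j => [[|[|[|[|[|[|[|//]]]]]]] ?] [[|[|[|[|[|[|[|//]]]]]]] ?];
  rewrite /metric_entry -!val_eqE /=; 
  rewrite !(mul0r, mulr0, addr0, add0r, mulr1) // /D; by field.
have [gu _] := mulmx1_unit gh.
by rewrite -[RHS]mul1mx -(mulVmx gu) -mulmxA gh mulmx1.
Qed.

End N62R.

(** * The conditions on a 3-form as polynomials in its coordinates *)

Definition g2_terms (i j : nat) : seq term :=
  let phi := basis_terms 7 3 in
  wedge_terms 7 (wedge_terms 7 (contract_terms 7 i phi) (contract_terms 7 j phi)) phi.

Definition pure_terms : seq term :=
  let phi := basis_terms 7 3 in wedge_terms 7 (diff_terms 7 n62R_terms phi) phi.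

Section Coordinates.
Variable R : realType.
Implicit Types (phi : extform R 7) (g : 'M[R]_7) (r E F G : R).

(* Coefficients in lexicographic order of the index sets.  For k = 3: 0, 1, 5, 15
   on W; 2, 6, 9, 16, 19, 25 are those of X, 3, 7, 10, 17, 20, 26 those of Y and
   4, 8, 11, 18, 21, 27 those of Z, each in the order 12, 13, 14, 23, 24, 34;
   34 is that of f567; the twelve others have one index in W. *)
Definition coord k phi (j : nat) : R := phi (supp 7 (nth [::] (ksubsets 7 k) j)).

Lemma coord_basis k phi : homog k phi -> phi = form_of 7 (coord k phi) (basis_terms 7 k).
Proof. exact: homog_form_of. Qed.

(** Discards the monomials that contain a vanishing variable before anything is expanded, which
    keeps the polynomials small. *)
Lemma sum_coef_vanish (e : nat -> R) (Z : seq nat) (l : seq term) :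
  (forall k, k \in Z -> e k = 0) ->
  \sum_(t <- l) coef_val e t.1 =
  \sum_(m <- [seq m <- map fst l | ~~ has (mem Z) m.2]) coef_val e m.
Proof.
move=> eZ; rewrite big_filter big_map [RHS]big_mkcond; apply: eq_bigr => t _.
case: ifPn => //; rewrite negbK => /hasP[k kt /eZ ek].
by rewrite coef_valE (big_rem k) //= ek mul0r mulr0.
Qed.

Definition vol_coef g (o : bool) : R := (-1) ^+ o * Num.sqrt (\det g).

(** Both sides of the specification are bilinear in the two vectors and take values in the line of
    7-forms, so comparing scalars on basis vectors suffices. The factor 6 clears the 1/6. *)
Lemma g2_data_specE phi g o : homog 3 phi ->
  g2_data_spec phi (g, o) <->
  inner_product g /\ forall i j : 'I_7, 6 * (g i j * vol_coef g o) =
    \sum_(t <- g2_terms i j) coef_val (coord 3 phi) t.1.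
Proof.
move=> h3; pose P (i j : 'I_7) := \sum_(t <- g2_terms i j) coef_val (coord 3 phi) t.1.
have PE (i j : 'I_7) :
    contract (delta_mx 0 i) phi \w contract (delta_mx 0 j) phi \w phi = P i j *: mono setT.
  rewrite [in LHS](coord_basis h3) !contract_form_of !wedge_form_of.
  rewrite form_of_top //; case: i j => [[|[|[|[|[|[|[|//]]]]]]] ?] [[|[|[|[|[|[|[|//]]]]]]] ?];
  by vm_compute.
have PvE (v w : 'rV[R]_7) : contract v phi \w contract w phi \w phi =
    (\sum_i \sum_j v 0 i * w 0 j * P i j) *: mono setT.
  rewrite (contract_suml v) (contract_suml w) wedge_suml wedge_suml scaler_suml.
  apply: eq_bigr => i _; rewrite wedge_sumr wedge_suml scaler_suml.
  by apply: eq_bigr => j _; rewrite !(wedgeZl, wedgeZr) PE !scalerA; congr (_ *: _); ring.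
have bE (v w : 'rV[R]_7) : bilin g v w = \sum_i \sum_j v 0 i * w 0 j * g i j.
  rewrite /bilin mxE exchange_big /=; apply: eq_bigr => j _.
  by rewrite !mxE mulr_suml; apply: eq_bigr => i _; ring.
rewrite /g2_data_spec /= /vol_form -/(vol_coef g o).
split=> -[gi H]; split=> //.
- move=> i j; have := H (delta_mx 0 i) (delta_mx 0 j).
  rewrite PE !scalerA => /ffunP/(_ setT).
  rewrite !extform_scaleE ffunE eqxx !mulr1 /bilin -rowE trmx_delta -colE !mxE => ->.
  by rewrite mulrA divff ?mul1r // pnatr_eq0.
- move=> v w; rewrite PvE bE !scalerA; congr (_ *: _).
  rewrite mulr_sumr mulr_suml; apply: eq_bigr => i _.
  rewrite mulr_sumr mulr_suml; apply: eq_bigr => j _.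
  by rewrite -[P i j]H; field.
Qed.

Lemma pureE phi : homog 3 phi ->
  ce_diff (@n62R R) phi \w phi = 0 <->
  \sum_(t <- pure_terms) coef_val (coord 3 phi) t.1 = 0.
Proof.
move=> h3; rewrite [X in ce_diff _ X](coord_basis h3) [X in _ \w X](coord_basis h3).
rewrite (ce_diff_form_of _ (ce_covec_n62R _)) wedge_form_of form_of_top; last by vm_compute.
split=> [/ffunP/(_ setT)|->]; last by rewrite scale0r.
by rewrite extform_scaleE !ffunE eqxx mulr1.
Qed.

Lemma homog_hodge g o phi : homog 3 phi -> homog 4 (hodge g o phi).
Proof.
move=> h3 K Kn; rewrite ffunE form_dot_monol big1 ?mulr0 ?mul0r // => J _.
rewrite /mono_dot; case: eqP => [KJ|_]; rewrite ?mulr0 // h3 ?mul0r // -KJ.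
apply: contra Kn => /eqP c3; have := cardsC K; rewrite c3 card_ord.
by move/(congr1 (subn^~ 3%N)); rewrite addnK => ->.
Qed.

(** Up to sign and volume, the coefficient at [t] is the inner product of [phi] with the monomial on
    the complement [t']. It expands over the 35 basis 3-forms into 3 x 3 minors of the inverse
    metric. *)
Lemma hodge_supp g o phi (h : nat -> nat -> R) (t : seq nat) : homog 3 phi ->
    (forall i j : 'I_7, invmx g i j = h i j) ->
  let t' := [seq i <- iota 0 7 | i \notin t] in size t' = 3%N ->
  hodge g o phi (supp 7 t) = (-1) ^+ inv 7 t' t *
    (\sum_(k <- iota 0 35) coord 3 phi k * det3 h t' (nth [::] (ksubsets 7 3) k)) *
    vol_coef g o.
Proof.
move=> h3 gh t' t3; rewrite ffunE extform_scaleE ffunE eqxx mulr1.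
rewrite setC_supp -/t' inversions_supp; congr (_ * _ * _).
have ct' : canon 7 t' = t'.
  by rewrite /canon; apply/eq_in_filter; rewrite // => i i7; rewrite mem_filter i7 andbT.
rewrite form_dot_monol.
have -> : \sum_(k <- iota 0 35) coord 3 phi k * det3 h t' (nth [::] (ksubsets 7 3) k) =
    \sum_(J <- [seq supp 7 s | s <- ksubsets 7 3]) phi J * mono_dot g (supp 7 t') J.
  rewrite big_map [RHS](big_nth [::]) /index_iota subn0.
  rewrite (_ : size _ = 35%N); last by vm_compute.
  apply: eq_big_seq => k; rewrite mem_iota /= => k35; congr (_ * _).
  have : nth [::] (ksubsets 7 3) k \in ksubsets 7 3 by rewrite mem_nth.
  by case/ksubsets_canon => sz ct; rewrite (mono_dot3 gh) ?ct' ?ct.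
set L := [seq supp 7 s | s <- ksubsets 7 3].
have uL : uniq L by apply: uniq_ksubsets.
rewrite [LHS](bigID (mem L)) /= [X in _ + X]big1 ?addr0 => [|J JL].
  by rewrite -big_uniq.
rewrite h3 ?mul0r //.
apply: contra JL => /eqP J3; have [s] := mem_ksubsets J; rewrite J3 => sL ->.
exact: map_f.
Qed.
End Coordinates.

Ltac compute_in_goal t :=
  let t' := eval vm_compute in t in have -> : t = t' by vm_compute.

Ltac compute_in H t := revert H; compute_in_goal t; intro H.

(** * The equation d * phi = 0 *)

Section Coclosed.
Variable R : realType.
Implicit Types (phi : extform R 7) (r E F G : R).

Lemma ce_diff4_eq0 (psi : extform R 7) : homog 4 psi ->
  let c := coord 4 psi in
  ce_diff (@n62R R) psi = 0 <->
  [/\ [/\ c 34%N = 0, c 33%N = 0, c 30%N = 0 & c 19%N = 0],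
      c 29%N = 0, c 16%N + c 23%N = 0 & c 18%N + c 25%N + c 31%N = 0].
Proof.
move=> h4 c; rewrite [X in ce_diff _ X](coord_basis h4).
rewrite (ce_diff_form_of _ (ce_covec_n62R _)) -/c.
apply: iff_trans; first exact: (@form_of_eq0 R 7 c).
set l := diff_terms _ _ _.
pose S := [seq canon 7 t.2 | t <- l].
apply: (@iff_trans _ (all (fun s => \sum_(m <- coefs 7 l s) coef_val c m == 0) (undup S))).
  split=> [H|/allP H s]; last by rewrite -mem_undup => /H/eqP.
  by apply/allP => s; rewrite mem_undup => /H->.
have -> : all (fun s => \sum_(m <- coefs 7 l s) coef_val c m == 0) (undup S) =
  all (fun L => \sum_(m <- L) coef_val c m == 0) [seq coefs 7 l s | s <- undup S].
  by rewrite all_map.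
compute_in_goal [seq coefs 7 l s | s <- undup S].
clearbody c; clear.
rewrite /= !big_cons !big_nil /coef_val /= !big_cons !big_nil /= !(mulr1, addr0).
rewrite !oppr_eq0 -opprD oppr_eq0 !addrA.
split.
  (* Nine equations come out, two of which repeat the vanishing of [c 33] and [c 34]. *)
  by case/and5P => /eqP -> /eqP -> /eqP -> /eqP -> /and5P [/eqP -> /eqP -> _ /eqP -> _].
by case=> [[-> -> -> ->] -> -> ->]; rewrite !eqxx.
Qed.

Lemma hodge_coefs phi r E F G o : homog 3 phi -> r != 0 -> E * G - F ^+ 2 != 0 ->
  let g := n62R_metric r E F G in
  let c := coord 4 (hodge g o phi) in let e := coord 3 phi in
  let D := E * G - F ^+ 2 in let s := vol_coef g o in
  [/\ [/\ c 34%N = s * e 0%N, c 33%N = - (s * e 1%N / r), c 30%N = s * e 4%N &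
       c 19%N = - (s * e 15%N / r)],
      [/\ c 29%N = s * e 5%N / r, c 16%N = s * e 18%N & c 23%N = s * e 11%N / r],
      c 18%N = s * (G * e 16%N - F * e 17%N) / D,
      c 25%N = s * (G * e 9%N - F * e 10%N) / (D * r) &
      c 31%N = - (s * (E * e 3%N - F * e 2%N) / D)].
Proof.
move=> h3 r0 D0 g c e D s.
pose h := metric_entry r^-1 (G / D) (- F / D) (E / D).
have gh (i j : 'I_7) : invmx g i j = h i j by rewrite metric_entry_inv // mxE.
have cE k : c k = hodge g o phi (supp 7 (nth [::] (ksubsets 7 4) k)) by [].
have H t := @hodge_supp _ g o phi h t h3 gh.
compute_in cE (ksubsets 7 4); compute_in H (ksubsets 7 3).
rewrite -/e -/s in H; clearbody c e s.
split; [split|split| | |].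
all: rewrite cE H // unlock /inv /canon /det3 /h /metric_entry /=.
all: by rewrite /D; field; rewrite ?r0 ?D0.
Qed.


(** The first four equations concern the coefficients of [phi] on W. Then [e 4] is the coefficient
    of f^127, while [e 11] and [e 18] are those of f^147 and f^237, all three in Z; the last
    equation relates X and Y. *)
Lemma coclosedE phi r E F G o : homog 3 phi -> r != 0 -> E * G - F ^+ 2 != 0 ->
    vol_coef (n62R_metric r E F G) o != 0 ->
  let e := coord 3 phi in
  ce_diff (@n62R R) (hodge (n62R_metric r E F G) o phi) = 0 <->
  [/\ [/\ e 0%N = 0, e 1%N = 0, e 5%N = 0 & e 15%N = 0], e 4%N = 0,
     e 11%N + r * e 18%N = 0 &
     r * (E * e 3%N - F * e 2%N) =
       r * (G * e 16%N - F * e 17%N) + (G * e 9%N - F * e 10%N)].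
Proof.
move=> h3 r0 D0 s0 e.
have [[e0 e1 e4 e15] [e5 e18 e11] e16 e9 e3] := hodge_coefs o h3 r0 D0.
apply: (iff_trans (ce_diff4_eq0 (homog_hodge _ _ h3))).
rewrite {}e0 {}e1 {}e4 {}e15 {}e5 {}e18 {}e11 {}e16 {}e9 {}e3 -/e.
set s := vol_coef _ o in s0 *; clearbody s e; clear phi h3.
(* Each equation on * phi is one on [phi] multiplied by a non-zero factor: [s], [s / r], its
   opposite, or [s] over (E G - F^2) r. *)
have cancel (k x y : R) : k != 0 -> y = k * x -> y = 0 -> x = 0.
  by move=> k0 -> /eqP; rewrite mulf_eq0 (negbTE k0) => /eqP.
have sr : s / r != 0 by rewrite mulf_neq0 ?invr_neq0.
have sDr : s / (E * G - F ^+ 2) / r != 0 by rewrite !mulf_neq0 ?invr_neq0.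
have nsr : - (s / r) != 0 by rewrite oppr_eq0.
split.
  case=> -[a0 a1 a4 a15] a5 a11 a3; split; [split|..].
  - exact: cancel s0 _ a0.
  - by apply: cancel nsr _ a1; field.
  - by apply: cancel sr _ a5; field.
  - by apply: cancel nsr _ a15; field.
  - exact: cancel s0 _ a4.
  - by apply: cancel sr _ a11; field.
  - by apply/eqP; rewrite eq_sym -subr_eq0; apply/eqP; apply: cancel sDr _ a3; field; rewrite r0 D0.
case=> -[-> -> -> ->] -> /(canRL (addrK _)) -> a3.
rewrite !(mulr0, mul0r, oppr0); split=> //; first by field.
set x := (X in X = 0); suff -> : x = s / (E * G - F ^+ 2) / r *
  (r * (G * e 16%N - F * e 17%N) + (G * e 9%N - F * e 10%N) - r * (E * e 3%N - F * e 2%N)).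
  by rewrite a3 subrr mulr0.
by rewrite /x; field; rewrite r0 D0.
Qed.
End Coclosed.

(** * A matrix equation between adjugates *)

Section MatrixLemma.
Variable R : realFieldType.
Implicit Types A B : 'M[R]_3.

(** The diagonal of A^T A consists of sums of squares. *)
Lemma mulmx_tr_eq0 m n (A : 'M[R]_(m, n)) : A^T *m A = 0 -> A = 0.
Proof.
move=> AA; apply/matrixP => i j; have := congr1 (fun M : 'M_n => M j j) AA.
rewrite !mxE => /eqP; rewrite psumr_eq0 => [/allP/(_ i)|k _]; last first.
  by rewrite mxE -expr2 sqr_ge0.
by rewrite mem_index_enum mxE -expr2 sqrf_eq0 => /(_ isT)/eqP.
Qed.

(** Multiplying on the left by A gives A A^T (adj B)^T = 0, because det A = 0. By positivity A^T
    (adj B)^T = 0, and multiplying on the right by B^T leaves det B times A^T. *)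
Lemma adj_balance_det0 A B : \adj A *m B = A^T *m (\adj B)^T ->
  \det A = 0 -> \det B != 0 -> A = 0.
Proof.
move=> AB A0 B0.
have AAC : A *m A^T *m (\adj B)^T = 0.
  by rewrite -mulmxA -AB mulmxA mul_mx_adj A0 mul_scalar_mx scale0r.
have AC : A^T *m (\adj B)^T = 0.
  by apply: mulmx_tr_eq0; rewrite trmx_mul !trmxK -mulmxA (mulmxA A) AAC mulmx0.
have := congr1 (fun M => M *m B^T) AC; rewrite -mulmxA -trmx_mul mul_mx_adj.
rewrite mul0mx tr_scalar_mx mul_mx_scalar => /eqP; rewrite scaler_eq0 (negbTE B0) /=.
by move=> /eqP At; apply: trmx_inj; rewrite At trmx0.
Qed.

(** Transposition exchanges the roles of A and B, which settles the cases with a zero determinant.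
    Otherwise, multiplying by A on the left and B^T on the right gives det A B B^T = det B A A^T,
    whose determinants force det A = det B. *)
Lemma adj_balance A B : \adj A *m B = A^T *m (\adj B)^T ->
  \det A != \det B -> A = 0 \/ B = 0.
Proof.
move=> AB dAB.
have BA : \adj B *m A = B^T *m (\adj A)^T.
  by have := congr1 trmx AB; rewrite !trmx_mul !trmxK => ->.
have [A0|A0] := eqVneq (\det A) 0.
  by left; apply: (adj_balance_det0 AB A0); rewrite -A0 eq_sym.
have [B0|B0] := eqVneq (\det B) 0; first by right; apply: (adj_balance_det0 BA B0).
have E1 : \det A *: (B *m B^T) = \det B *: (A *m A^T).
  rewrite -mul_scalar_mx -mul_mx_adj -mulmxA (mulmxA (\adj A)) AB.
  by rewrite -mulmxA -trmx_mul mul_mx_adj tr_scalar_mx mul_mx_scalar -scalemxAr.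
have := congr1 determinant E1; rewrite !detZ !det_mulmx !det_tr => /eqP.
rewrite -subr_eq0.
have -> : \det A ^+ 3 * (\det B * \det B) - \det B ^+ 3 * (\det A * \det A) =
  (\det A * \det B) ^+ 2 * (\det A - \det B) by ring.
rewrite mulf_eq0 expf_eq0 /= mulf_eq0 (negbTE A0) (negbTE B0) /= subr_eq0.
by rewrite (negbTE dAB).
Qed.


End MatrixLemma.

(** * The block of the metric on W *)

Definition gram (R : realType) (e : nat -> R) (i j : nat) : R :=
  \sum_(t <- g2_terms i j) coef_val e t.1.

Ltac gram_list i j :=
  let l := constr:([seq m <- map fst (g2_terms i j) | ~~ has (mem [:: 0; 1; 5; 15]%N) m.2]) in
  eval vm_compute in l.

(** Turns [P], about an entry of the metric times six times the volume coefficient, into an explicit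
    polynomial equation; the monomials with a coefficient of phi on W are dropped first. *)
Ltac expand_gram gE eE P :=
  revert P;
  match goal with |- gram _ ?i ?j = _ -> _ =>
    let l := gram_list i j in
    rewrite (gE i j l); [rewrite unlock /coef_val unlock /= ?eE | by vm_compute]
  end;
  intro P.

Section Gram.
Variable R : realType.

Lemma adj3E (A : 'M[R]_3) :
  [/\ [/\ (\adj A) 0 0 = A 1 1 * A 2 2 - A 1 2 * A 2 1,
          (\adj A) 0 1 = A 0 2 * A 2 1 - A 0 1 * A 2 2 &
          (\adj A) 0 2 = A 0 1 * A 1 2 - A 0 2 * A 1 1],
      [/\ (\adj A) 1 0 = A 1 2 * A 2 0 - A 1 0 * A 2 2,
          (\adj A) 1 1 = A 0 0 * A 2 2 - A 0 2 * A 2 0 &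
          (\adj A) 1 2 = A 0 2 * A 1 0 - A 0 0 * A 1 2] &
      [/\ (\adj A) 2 0 = A 1 0 * A 2 1 - A 1 1 * A 2 0,
          (\adj A) 2 1 = A 0 1 * A 2 0 - A 0 0 * A 2 1 &
          (\adj A) 2 2 = A 0 0 * A 1 1 - A 0 1 * A 1 0]].
Proof.
pose f i j := A (inord i) (inord j).
have Af i j : A i j = f i j by rewrite /f !inord_val.
by split; split; rewrite mxE /cofactor det2E !mxE !Af /= /bump /=; ring.
Qed.

Lemma gramE (e : nat -> R) i j l : e 0%N = 0 -> e 1%N = 0 -> e 5%N = 0 -> e 15%N = 0 ->
  [seq m <- map fst (g2_terms i j) | ~~ has (mem [:: 0; 1; 5; 15]%N) m.2] = l ->
  gram e i j = \sum_(m <- l) coef_val e m.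
Proof.
move=> e0 e1 e5 e15 <-; apply: sum_coef_vanish => k.
by rewrite !inE => /or4P[] /eqP->.
Qed.

(** The multipliers [k1], [k2] of the equations used are a certificate, which leaves an identity for
    [ring]. *)
Lemma lin_comb2 (k1 k2 a b x1 y1 x2 y2 : R) : x1 = y1 -> x2 = y2 ->
  a - b = k1 * (x1 - y1) + k2 * (x2 - y2) -> a = b.
Proof. by move=> -> -> /eqP; rewrite !subrr !mulr0 addr0 subr_eq0 => /eqP. Qed.

Lemma lin_comb4 (k1 k2 k3 k4 a b x1 y1 x2 y2 x3 y3 x4 y4 : R) :
  x1 = y1 -> x2 = y2 -> x3 = y3 -> x4 = y4 ->
  a - b = k1 * (x1 - y1) + k2 * (x2 - y2) + k3 * (x3 - y3) + k4 * (x4 - y4) -> a = b.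
Proof. by move=> -> -> -> -> /eqP; rewrite !subrr !mulr0 !addr0 subr_eq0 => /eqP. Qed.

Arguments lin_comb2 k1 k2 {a b x1 y1 x2 y2}.
Arguments lin_comb4 k1 k2 k3 k4 {a b x1 y1 x2 y2 x3 y3 x4 y4}.

Definition mx3 (l : seq (seq R)) : 'M[R]_3 := \matrix_(i, j) nth 0 (nth [::] l i) j.

(** The numbers [k12] to [k34] are positions in [coord]. For the metric diag(1, 1, 1, u^2) on W,
    these 2-forms are the self-dual ones when u > 0 and the anti-self-dual ones when u < 0. *)
Definition dual_type (e : nat -> R) (u : R) (k12 k13 k14 k23 k24 k34 : nat)
    (x1 x2 x3 : R) : Prop :=
  [/\ e k12 = x1, e k13 = x2, e k23 = x3 &
   [/\ e k34 = u * x1, e k24 = - (u * x2) & e k14 = u * x3]].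

(** The determinant in the conclusion is that of whichever of the two matrices A, B survives; it
    makes X, Y, Z independent. *)
Lemma gram_split (e : nat -> R) (q : R) (s : R) :
    e 0%N = 0 -> e 1%N = 0 -> e 5%N = 0 -> e 15%N = 0 -> q != 0 -> s != 0 ->
    (forall i j : nat, (i < 4)%N -> (j < 4)%N ->
       gram e i j = if i == j then (if i == 3%N then q ^+ 2 * s else s) else 0) ->
  exists u x1 x2 x3 y1 y2 y3 z1 z2 z3, [/\ (u = q) \/ (u = - q),
    dual_type e u 2 6 9 16 19 25 x1 x2 x3,
    dual_type e u 3 7 10 17 20 26 y1 y2 y3,
    dual_type e u 4 8 11 18 21 27 z1 z2 z3 &
    x1 * (y2 * z3 - y3 * z2) - x2 * (y1 * z3 - y3 * z1) + x3 * (y1 * z2 - y2 * z1) != 0].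
Proof.
move=> e0 e1 e5 e15 q0 s0 H.
(* Self-dual ([a]) and anti-self-dual ([b]) coordinates of X; those of Y and Z follow, and are the
   other rows of A and B. *)
pose ax1 := (e 2%N + e 25%N / q) / 2; pose ba1 := (e 2%N - e 25%N / q) / 2.
pose ax2 := (e 6%N - e 19%N / q) / 2; pose ba2 := (e 6%N + e 19%N / q) / 2.
pose ax3 := (e 16%N + e 9%N / q) / 2; pose ba3 := (e 16%N - e 9%N / q) / 2.
have e2 : e 2%N = ax1 + ba1 by rewrite /ax1 /ba1; field.
have e25 : e 25%N = q * (ax1 - ba1) by rewrite /ax1 /ba1; field.
have e6 : e 6%N = ax2 + ba2 by rewrite /ax2 /ba2; field.
have e19 : e 19%N = - (q * (ax2 - ba2)) by rewrite /ax2 /ba2; field.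
have e16 : e 16%N = ax3 + ba3 by rewrite /ax3 /ba3; field.
have e9 : e 9%N = q * (ax3 - ba3) by rewrite /ax3 /ba3; field.
clearbody ax1 ba1 ax2 ba2 ax3 ba3.
pose ay1 := (e 3%N + e 26%N / q) / 2; pose bb1 := (e 3%N - e 26%N / q) / 2.
pose ay2 := (e 7%N - e 20%N / q) / 2; pose bb2 := (e 7%N + e 20%N / q) / 2.
pose ay3 := (e 17%N + e 10%N / q) / 2; pose bb3 := (e 17%N - e 10%N / q) / 2.
have e3 : e 3%N = ay1 + bb1 by rewrite /ay1 /bb1; field.
have e26 : e 26%N = q * (ay1 - bb1) by rewrite /ay1 /bb1; field.
have e7 : e 7%N = ay2 + bb2 by rewrite /ay2 /bb2; field.
have e20 : e 20%N = - (q * (ay2 - bb2)) by rewrite /ay2 /bb2; field.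
have e17 : e 17%N = ay3 + bb3 by rewrite /ay3 /bb3; field.
have e10 : e 10%N = q * (ay3 - bb3) by rewrite /ay3 /bb3; field.
clearbody ay1 bb1 ay2 bb2 ay3 bb3.
pose az1 := (e 4%N + e 27%N / q) / 2; pose bc1 := (e 4%N - e 27%N / q) / 2.
pose az2 := (e 8%N - e 21%N / q) / 2; pose bc2 := (e 8%N + e 21%N / q) / 2.
pose az3 := (e 18%N + e 11%N / q) / 2; pose bc3 := (e 18%N - e 11%N / q) / 2.
have e4 : e 4%N = az1 + bc1 by rewrite /az1 /bc1; field.
have e27 : e 27%N = q * (az1 - bc1) by rewrite /az1 /bc1; field.
have e8 : e 8%N = az2 + bc2 by rewrite /az2 /bc2; field.
have e21 : e 21%N = - (q * (az2 - bc2)) by rewrite /az2 /bc2; field.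
have e18 : e 18%N = az3 + bc3 by rewrite /az3 /bc3; field.
have e11 : e 11%N = q * (az3 - bc3) by rewrite /az3 /bc3; field.
clearbody az1 bc1 az2 bc2 az3 bc3.
have gE := gramE e0 e1 e5 e15; have eE := (e2, e6, e9, e16, e19, e25, e3, e7, e10, e17, e20, e26,
  e4, e8, e11, e18, e21, e27).
have P00 := H 0%N 0%N isT isT; expand_gram gE eE P00.
have P01 := H 0%N 1%N isT isT; expand_gram gE eE P01.
have P02 := H 0%N 2%N isT isT; expand_gram gE eE P02.
have P03 := H 0%N 3%N isT isT; expand_gram gE eE P03.
have P11 := H 1%N 1%N isT isT; expand_gram gE eE P11.
have P12 := H 1%N 2%N isT isT; expand_gram gE eE P12.
have P13 := H 1%N 3%N isT isT; expand_gram gE eE P13.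
have P22 := H 2%N 2%N isT isT; expand_gram gE eE P22.
have P23 := H 2%N 3%N isT isT; expand_gram gE eE P23.
have P33 := H 3%N 3%N isT isT; expand_gram gE eE P33.
pose lA := [:: [:: ax1; ax2; ax3]; [:: ay1; ay2; ay3]; [:: az1; az2; az3]]; pose A := mx3 lA.
pose lB := [:: [:: ba1; ba2; ba3]; [:: bb1; bb2; bb3]; [:: bc1; bc2; bc3]]; pose B := mx3 lB.
have AB : \adj A *m B = A^T *m (\adj B)^T.
  have [[A00 A01 A02] [A10 A11 A12] [A20 A21 A22]] := adj3E A.
  have [[B00 B01 B02] [B10 B11 B12] [B20 B21 B22]] := adj3E B.
  have o3 (P : 'I_3 -> Prop) : P 0 -> P 1 -> P 2 -> forall i, P i.
    move=> p0 p1 p2 [[|[|[|//]]] hi].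
    - by rewrite (_ : Ordinal hi = 0) //; apply: val_inj.
    - by rewrite (_ : Ordinal hi = 1) //; apply: val_inj.
    - by rewrite (_ : Ordinal hi = 2) //; apply: val_inj.
  have mulE (M N : 'M[R]_3) i j :
      (M *m N) i j = M i 0 * N 0 j + M i 1 * N 1 j + M i 2 * N 2 j.
    rewrite mxE !big_ord_recl big_ord0 addr0 addrA.
    congr (_ + M i _ * N _ j + M i _ * N _ j); exact: val_inj.
  have trE (M : 'M[R]_3) i j : M^T i j = M j i by rewrite mxE.
  have AE (i j : 'I_3) : A i j = nth 0 (nth [::] lA i) j by rewrite mxE.
  have BE (i j : 'I_3) : B i j = nth 0 (nth [::] lB i) j by rewrite mxE.
  clearbody A B.
  (* The nine entries match the trace-free symmetric forms on W, which vanish for a block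
     proportional to diag(1, 1, 1, q^2): on the diagonal, the combination of [P00], [P11], [P22],
     [P33] cancels [s]; elsewhere two off-diagonal equations are combined. *)
  have q3 : 24 * q ^+ 3 != 0 by rewrite mulf_neq0 ?expf_neq0 // pnatr_eq0.
  apply/matrixP => i j; rewrite mulE mulE !trE; apply: (mulfI q3).
  elim/o3: i; elim/o3: j; rewrite ?(A00, A01, A02, A10, A11, A12, A20, A21, A22);
  rewrite ?(B00, B01, B02, B10, B11, B12, B20, B21, B22) !AE !BE /=.
  - by apply: (lin_comb4 (- q ^+ 2) (- q ^+ 2) (q ^+ 2) 1 P00 P11 P22 P33); ring.
  - by apply: (lin_comb2 (2 * q) (- (2 * q ^+ 2)) P03 P12); ring.
  - by apply: (lin_comb2 (2 * q ^+ 2) (2 * q) P02 P13); ring.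
  - by apply: (lin_comb2 (- (2 * q)) (- (2 * q ^+ 2)) P03 P12); ring.
  - by apply: (lin_comb4 (- q ^+ 2) (q ^+ 2) (- q ^+ 2) 1 P00 P11 P22 P33); ring.
  - by apply: (lin_comb2 (- (2 * q ^+ 2)) (2 * q) P01 P23); ring.
  - by apply: (lin_comb2 (2 * q ^+ 2) (- (2 * q)) P02 P13); ring.
  - by apply: (lin_comb2 (- (2 * q ^+ 2)) (- (2 * q)) P01 P23); ring.
  - by apply: (lin_comb4 (q ^+ 2) (- q ^+ 2) (- q ^+ 2) 1 P00 P11 P22 P33); ring.
(* The remaining component, the trace, gives the difference of the determinants. *)
have dAB : \det A != \det B.
  rewrite -subr_eq0; have q3 : 6 * q ^+ 3 != 0 by rewrite mulf_neq0 ?expf_neq0 // pnatr_eq0.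
  suff : 6 * q ^+ 3 * (\det A - \det B) = - (q ^+ 2 * s).
    move=> E; apply/eqP => d0; move: E; rewrite d0 mulr0 => /eqP.
    by rewrite eq_sym oppr_eq0 mulf_eq0 expf_eq0 (negbTE q0) (negbTE s0).
  rewrite !det3E !mxE /=.
  by apply: (lin_comb4 (- (q ^+ 2 / 4)) (- (q ^+ 2 / 4)) (- (q ^+ 2 / 4)) (- (1 / 4))
    P00 P11 P22 P33); field.
have [A0|B0] := adj_balance AB dAB.
(* A = 0 leaves the anti-self-dual parts, hence u = - q. *)
- have a0 (i j : 'I_3) : A i j = 0 by rewrite A0 mxE.
  have := (a0 0 0, a0 0 1, a0 0 2, (a0 1 0, a0 1 1, a0 1 2, (a0 2 0, a0 2 1, a0 2 2))).
  rewrite !mxE /= => -[[[ax10 ax20] ax30] [[[ay10 ay20] ay30] [[az10 az20] az30]]].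
  exists (- q), ba1, ba2, ba3, bb1, bb2, bb3, bc1, bc2, bc3.
  rewrite /dual_type !eE.
  rewrite ax10 ax20 ax30 ay10 ay20 ay30 az10 az20 az30.
  rewrite !add0r !mulrN !mulNr !opprK; split=> //; first by right.
  by move: dAB; rewrite eq_sym A0 det0 det3E !mxE.
- have b0 (i j : 'I_3) : B i j = 0 by rewrite B0 mxE.
  have := (b0 0 0, b0 0 1, b0 0 2, (b0 1 0, b0 1 1, b0 1 2, (b0 2 0, b0 2 1, b0 2 2))).
  rewrite !mxE /= => -[[[bx10 bx20] bx30] [[[by10 by20] by30] [[bz10 bz20] bz30]]].
  exists q, ax1, ax2, ax3, ay1, ay2, ay3, az1, az2, az3.
  rewrite /dual_type !eE.
  rewrite bx10 bx20 bx30 by10 by20 by30 bz10 bz20 bz30.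
  rewrite !addr0 !subr0; split=> //; first by left.
  by move: dAB; rewrite B0 det0 det3E !mxE.
Qed.
End Gram.

(** * The block of the metric between W and f5, f6, f7 *)

Section Mixed.
Variable R : realType.

(** Cramer's rule: each unknown is isolated by a row of the adjugate. *)
Lemma cramer3 (x1 x2 x3 y1 y2 y3 z1 z2 z3 t1 t2 t3 : R) :
    x1 * (y2 * z3 - y3 * z2) - x2 * (y1 * z3 - y3 * z1) + x3 * (y1 * z2 - y2 * z1) != 0 ->
    x1 * t1 + x2 * t2 + x3 * t3 = 0 -> y1 * t1 + y2 * t2 + y3 * t3 = 0 ->
    z1 * t1 + z2 * t2 + z3 * t3 = 0 ->
  [/\ t1 = 0, t2 = 0 & t3 = 0].
Proof.
set d := (X in X != 0) => d0 hx hy hz.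
split; apply: (mulfI d0); rewrite mulr0.
- transitivity ((y2 * z3 - y3 * z2) * (x1 * t1 + x2 * t2 + x3 * t3)
    + (x3 * z2 - x2 * z3) * (y1 * t1 + y2 * t2 + y3 * t3)
    + (x2 * y3 - x3 * y2) * (z1 * t1 + z2 * t2 + z3 * t3)); first by rewrite /d; ring.
  by rewrite hx hy hz !mulr0 !addr0.
- transitivity ((y3 * z1 - y1 * z3) * (x1 * t1 + x2 * t2 + x3 * t3)
    + (x1 * z3 - x3 * z1) * (y1 * t1 + y2 * t2 + y3 * t3)
    + (x3 * y1 - x1 * y3) * (z1 * t1 + z2 * t2 + z3 * t3)); first by rewrite /d; ring.
  by rewrite hx hy hz !mulr0 !addr0.
- transitivity ((y1 * z2 - y2 * z1) * (x1 * t1 + x2 * t2 + x3 * t3)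
    + (x2 * z1 - x1 * z2) * (y1 * t1 + y2 * t2 + y3 * t3)
    + (x1 * y2 - x2 * y1) * (z1 * t1 + z2 * t2 + z3 * t3)); first by rewrite /d; ring.
  by rewrite hx hy hz !mulr0 !addr0.
Qed.

Lemma lin_comb1 (k a b x y : R) : x = y -> a - b = k * (x - y) -> a = b.
Proof. by move=> -> /eqP; rewrite subrr mulr0 subr_eq0 => /eqP. Qed.
Arguments lin_comb1 k {a b x y}.

(* With L_1 = l67, L_2 = - l57, L_3 = l56 and N = A^T L, the equations of the mixed
   block are A b = 0 where b is linear in N, with coefficients in u only. *)
Lemma gram_mixed (e : nat -> R) (u x1 x2 x3 y1 y2 y3 z1 z2 z3 : R) :
    e 0%N = 0 -> e 1%N = 0 -> e 5%N = 0 -> e 15%N = 0 -> u != 0 ->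
    dual_type e u 2 6 9 16 19 25 x1 x2 x3 ->
    dual_type e u 3 7 10 17 20 26 y1 y2 y3 ->
    dual_type e u 4 8 11 18 21 27 z1 z2 z3 ->
    x1 * (y2 * z3 - y3 * z2) - x2 * (y1 * z3 - y3 * z1) + x3 * (y1 * z2 - y2 * z1) != 0 ->
    (forall i j : nat, (i < 4)%N -> (3 < j < 7)%N -> gram e i j = 0) ->
  forall k, k \in [:: 12; 22; 28; 31; 13; 23; 29; 32; 14; 24; 30; 33]%N -> e k = 0.
Proof.
move=> e0 e1 e5 e15 u0 [e2 e6 e16 [e25 e19 e9]] [e3 e7 e17 [e26 e20 e10]]
  [e4 e8 e18 [e27 e21 e11]] det_neq0 H.
(* In [nik], [i] is the index in W, from 0, and [k] is the column of A, from 1. *)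
pose n01 := x1 * e 14%N - y1 * e 13%N + z1 * e 12%N.
pose n02 := x2 * e 14%N - y2 * e 13%N + z2 * e 12%N.
pose n03 := x3 * e 14%N - y3 * e 13%N + z3 * e 12%N.
pose n11 := x1 * e 24%N - y1 * e 23%N + z1 * e 22%N.
pose n12 := x2 * e 24%N - y2 * e 23%N + z2 * e 22%N.
pose n13 := x3 * e 24%N - y3 * e 23%N + z3 * e 22%N.
pose n21 := x1 * e 30%N - y1 * e 29%N + z1 * e 28%N.
pose n22 := x2 * e 30%N - y2 * e 29%N + z2 * e 28%N.
pose n23 := x3 * e 30%N - y3 * e 29%N + z3 * e 28%N.
pose n31 := x1 * e 33%N - y1 * e 32%N + z1 * e 31%N.
pose n32 := x2 * e 33%N - y2 * e 32%N + z2 * e 31%N.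
pose n33 := x3 * e 33%N - y3 * e 32%N + z3 * e 31%N.
have gE := gramE e0 e1 e5 e15; have eE := (e2, e6, e9, e16, e19, e25, e3, e7, e10, e17, e20, e26,
  e4, e8, e11, e18, e21, e27).
have M0 := H 0%N 4%N isT isT; expand_gram gE eE M0.
have M1 := H 0%N 5%N isT isT; expand_gram gE eE M1.
have M2 := H 0%N 6%N isT isT; expand_gram gE eE M2.
have [b01 b02 b03] : [/\ u * n01 + u * n23 - n32 = 0,
    u * n02 - u * n13 + n31 = 0 &
    u * n03 + u * n12 - u * n21 = 0].
  apply: (cramer3 det_neq0).
  - by apply: (lin_comb1 (1 / 3) M0); rewrite /n01 /n02 /n03 /n11 /n12 /n13
      /n21 /n22 /n23 /n31 /n32 /n33; field.
  - by apply: (lin_comb1 (1 / 3) M1); rewrite /n01 /n02 /n03 /n11 /n12 /n13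
      /n21 /n22 /n23 /n31 /n32 /n33; field.
  - by apply: (lin_comb1 (1 / 3) M2); rewrite /n01 /n02 /n03 /n11 /n12 /n13
      /n21 /n22 /n23 /n31 /n32 /n33; field.
clear M0 M1 M2.
have M0 := H 1%N 4%N isT isT; expand_gram gE eE M0.
have M1 := H 1%N 5%N isT isT; expand_gram gE eE M1.
have M2 := H 1%N 6%N isT isT; expand_gram gE eE M2.
have [b11 b12 b13] : [/\ u * n11 - u * n22 - n33 = 0,
    u * n03 + u * n12 + u * n21 = 0 &
    - (u * n02) + u * n13 + n31 = 0].
  apply: (cramer3 det_neq0).
  - by apply: (lin_comb1 (1 / 3) M0); rewrite /n01 /n02 /n03 /n11 /n12 /n13
      /n21 /n22 /n23 /n31 /n32 /n33; field.
  - by apply: (lin_comb1 (1 / 3) M1); rewrite /n01 /n02 /n03 /n11 /n12 /n13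
      /n21 /n22 /n23 /n31 /n32 /n33; field.
  - by apply: (lin_comb1 (1 / 3) M2); rewrite /n01 /n02 /n03 /n11 /n12 /n13
      /n21 /n22 /n23 /n31 /n32 /n33; field.
clear M0 M1 M2.
have M0 := H 2%N 4%N isT isT; expand_gram gE eE M0.
have M1 := H 2%N 5%N isT isT; expand_gram gE eE M1.
have M2 := H 2%N 6%N isT isT; expand_gram gE eE M2.
have [b21 b22 b23] : [/\ - (u * n03) + u * n12 + u * n21 = 0,
    - (u * n11) + u * n22 - n33 = 0 &
    u * n01 + u * n23 + n32 = 0].
  apply: (cramer3 det_neq0).
  - by apply: (lin_comb1 (1 / 3) M0); rewrite /n01 /n02 /n03 /n11 /n12 /n13
      /n21 /n22 /n23 /n31 /n32 /n33; field.
  - by apply: (lin_comb1 (1 / 3) M1); rewrite /n01 /n02 /n03 /n11 /n12 /n13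
      /n21 /n22 /n23 /n31 /n32 /n33; field.
  - by apply: (lin_comb1 (1 / 3) M2); rewrite /n01 /n02 /n03 /n11 /n12 /n13
      /n21 /n22 /n23 /n31 /n32 /n33; field.
clear M0 M1 M2.
have M0 := H 3%N 4%N isT isT; expand_gram gE eE M0.
have M1 := H 3%N 5%N isT isT; expand_gram gE eE M1.
have M2 := H 3%N 6%N isT isT; expand_gram gE eE M2.
have [b31 b32 b33] : [/\ u * (u * n02 + u * n13 + n31) = 0,
    u * (- (u * n01) + u * n23 + n32) = 0 &
    u * (- (u * n11) - u * n22 + n33) = 0].
  apply: (cramer3 det_neq0).
  - by apply: (lin_comb1 (1 / 3) M0); rewrite /n01 /n02 /n03 /n11 /n12 /n13
      /n21 /n22 /n23 /n31 /n32 /n33; field.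
  - by apply: (lin_comb1 (1 / 3) M1); rewrite /n01 /n02 /n03 /n11 /n12 /n13
      /n21 /n22 /n23 /n31 /n32 /n33; field.
  - by apply: (lin_comb1 (1 / 3) M2); rewrite /n01 /n02 /n03 /n11 /n12 /n13
      /n21 /n22 /n23 /n31 /n32 /n33; field.
clear M0 M1 M2.
have u2 (x : R) : u * x = 0 -> x = 0 by move=> ux; apply: (mulfI u0); rewrite mulr0.
have {b31 b32 b33} [b31 b32 b33] := And3 (u2 _ b31) (u2 _ b32) (u2 _ b33).
(* The twelve equations fall into four independent systems of three unknowns each, with u times
   [nik] as unknown where u is a factor. *)
have z01 : n01 = 0 by apply: u2; move: b01 b23 b32; clear; lra.
have z23 : n23 = 0 by apply: u2; move: b01 b23 b32; clear; lra.
have z32 : n32 = 0 by move: b01 b23 b32; clear; lra.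
have z02 : n02 = 0 by apply: u2; move: b02 b13 b31; clear; lra.
have z13 : n13 = 0 by apply: u2; move: b02 b13 b31; clear; lra.
have z31 : n31 = 0 by move: b02 b13 b31; clear; lra.
have z03 : n03 = 0 by apply: u2; move: b03 b12 b21; clear; lra.
have z12 : n12 = 0 by apply: u2; move: b03 b12 b21; clear; lra.
have z21 : n21 = 0 by apply: u2; move: b03 b12 b21; clear; lra.
have z11 : n11 = 0 by apply: u2; move: b11 b22 b33; clear; lra.
have z22 : n22 = 0 by apply: u2; move: b11 b22 b33; clear; lra.
have z33 : n33 = 0 by move: b11 b22 b33; clear; lra.
(* N = A^T L vanishes, and A^T has the same determinant as A, so L = 0. *)
have det_tr : x1 * (y2 * z3 - z2 * y3) - y1 * (x2 * z3 - z2 * x3) + z1 * (x2 * y3 - y2 * x3) != 0.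
  by apply: contra det_neq0 => /eqP d0; apply/eqP; rewrite -[RHS]d0; ring.
have [l14 l13 l12] : [/\ e 14%N = 0, - e 13%N = 0 & e 12%N = 0].
  by apply: (cramer3 det_tr); rewrite mulrN; assumption.
have [l24 l23 l22] : [/\ e 24%N = 0, - e 23%N = 0 & e 22%N = 0].
  by apply: (cramer3 det_tr); rewrite mulrN; assumption.
have [l30 l29 l28] : [/\ e 30%N = 0, - e 29%N = 0 & e 28%N = 0].
  by apply: (cramer3 det_tr); rewrite mulrN; assumption.
have [l33 l32 l31] : [/\ e 33%N = 0, - e 32%N = 0 & e 31%N = 0].
  by apply: (cramer3 det_tr); rewrite mulrN; assumption.
have opp0 (x : R) : - x = 0 -> x = 0 by move=> /eqP; rewrite oppr_eq0 => /eqP.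
move=> k; rewrite !inE => H0.
by do ?case/orP: H0 => [/eqP->|H0]; try (by []); try exact: opp0; move/eqP: H0 => ->.
Qed.
End Mixed.

(** * Necessity of the conditions *)

Section Forward.
Variable R : realType.

(** All coefficients except those of X, Y, Z and f^567. *)
Definition nonblock : seq nat :=
  [:: 0; 1; 5; 15; 12; 22; 28; 31; 13; 23; 29; 32; 14; 24; 30; 33]%N.

(** Forms of this type satisfy X /\ Y = 2 u (x . y) f^1234. Each of the three factors can supply the
    f^567 part, whence 6 = 3 * 2. *)
Lemma gram_center (e : nat -> R) (u x1 x2 x3 y1 y2 y3 z1 z2 z3 : R) :
    (forall k, k \in nonblock -> e k = 0) ->
    dual_type e u 2 6 9 16 19 25 x1 x2 x3 ->
    dual_type e u 3 7 10 17 20 26 y1 y2 y3 ->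
    dual_type e u 4 8 11 18 21 27 z1 z2 z3 ->
  let t := 6 * e 34%N * u in
  [/\ [/\ gram e 4 4 = t * (x1 ^+ 2 + x2 ^+ 2 + x3 ^+ 2),
      gram e 5 5 = t * (y1 ^+ 2 + y2 ^+ 2 + y3 ^+ 2) &
      gram e 6 6 = t * (z1 ^+ 2 + z2 ^+ 2 + z3 ^+ 2)],
     gram e 4 5 = t * (x1 * y1 + x2 * y2 + x3 * y3),
     gram e 4 6 = t * (x1 * z1 + x2 * z2 + x3 * z3) &
     gram e 5 6 = t * (y1 * z1 + y2 * z2 + y3 * z3)].
Proof.
move=> eZ [e2 e6 e16 [e25 e19 e9]] [e3 e7 e17 [e26 e20 e10]] [e4 e8 e18 [e27 e21 e11]] t.
have eE := (e2, e6, e9, e16, e19, e25, e3, e7, e10, e17, e20, e26, e4, e8, e11, e18, e21, e27).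
split; first split.
all: rewrite /gram (sum_coef_vanish _ eZ).
all: match goal with |- context [filter ?a ?l] => compute_in_goal (filter a l) end.
all: rewrite unlock /coef_val unlock /= ?eE /t; ring.
Qed.

(** Here f^12 /\ X = u x1 f^1234 and (f^14 + f^23) /\ Y = (1 + u) y3 f^1234. The factor 2 arises
    because the f^567 part may come from d phi or from phi. *)
Lemma pure_split (e : nat -> R) (u x1 x2 x3 y1 y2 y3 z1 z2 z3 : R) :
    (forall k, k \in nonblock -> e k = 0) ->
    dual_type e u 2 6 9 16 19 25 x1 x2 x3 ->
    dual_type e u 3 7 10 17 20 26 y1 y2 y3 ->
    dual_type e u 4 8 11 18 21 27 z1 z2 z3 ->
  \sum_(t <- pure_terms) coef_val e t.1 = 2 * e 34%N * (u * x1 + (1 + u) * y3).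
Proof.
move=> eZ [e2 e6 e16 [e25 e19 e9]] [e3 e7 e17 [e26 e20 e10]] [e4 e8 e18 [e27 e21 e11]].
have eE := (e2, e6, e9, e16, e19, e25, e3, e7, e10, e17, e20, e26, e4, e8, e11, e18, e21, e27).
rewrite (sum_coef_vanish _ eZ).
match goal with |- context [filter ?a ?l] => compute_in_goal (filter a l) end.
by rewrite unlock /coef_val unlock /= ?eE; ring.
Qed.

(** Once z1 = z3 = 0, orthogonality to Z gives x2 = y2 = 0. The two remaining equations read u (x1,
    x3) = (1 + u) (- y3, y1): a quarter turn with scaling, which yields both F = 0 and the ratio of
    G to E. *)
Lemma split_conclusion (r u t E F G x1 x2 x3 y1 y2 y3 z1 z2 z3 : R) :
    r = u ^+ 2 -> u != 0 -> t != 0 ->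
    x1 * (y2 * z3 - y3 * z2) - x2 * (y1 * z3 - y3 * z1) + x3 * (y1 * z2 - y2 * z1) != 0 ->
    E = t * (x1 ^+ 2 + x2 ^+ 2 + x3 ^+ 2) -> G = t * (y1 ^+ 2 + y2 ^+ 2 + y3 ^+ 2) ->
    F = t * (x1 * y1 + x2 * y2 + x3 * y3) ->
    t * (x1 * z1 + x2 * z2 + x3 * z3) = 0 -> t * (y1 * z1 + y2 * z2 + y3 * z3) = 0 ->
    z1 = 0 -> u * z3 + r * z3 = 0 ->
    r * (E * y1 - F * x1) = r * (G * x3 - F * y3) + (G * (u * x3) - F * (u * y3)) ->
    u * x1 + (1 + u) * y3 = 0 ->
  [/\ F = 0, G * (1 + u) ^+ 2 = E * u ^+ 2 & 1 + u != 0].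
Proof.
move=> rE u0 t0 d0 EE GE FE xz yz z10 z3E sE pE.
have cancel (k x : R) : k != 0 -> k * x = 0 -> x = 0.
  by move=> k0 kx; apply: (mulfI k0); rewrite mulr0.
(* If u = -1, the column (x1, y1, z1) vanishes, against the determinant. *)
have u1 : 1 + u != 0.
  apply: contra (d0) => /eqP u1; apply/eqP.
  have x10 : x1 = 0 by apply: (cancel u) => //; rewrite -pE u1 mul0r addr0.
  have y10 : y1 = 0.
    have uN : u = -1 by rewrite -(addKr 1 u) u1 addr0.
    have E0 : E * y1 = 0.
      by move: sE; rewrite rE uN x10 => sE; lra.
    apply: (cancel E) => //; rewrite EE mulf_neq0 //; apply: contra (d0) => /eqP n0; apply/eqP.
    have : x2 = 0 /\ x3 = 0 by move: n0; rewrite x10; nra.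
    by case=> -> ->; rewrite x10; ring.
  by rewrite x10 y10 z10; ring.
have z30 : z3 = 0.
  apply: (cancel (u * (1 + u))); first by rewrite mulf_neq0.
  by rewrite -z3E rE; ring.
subst z1 z3.
have z20 : z2 != 0 by apply: contra (d0) => /eqP->; apply/eqP; ring.
have x20 : x2 = 0.
  by apply: (cancel (t * z2)); [rewrite mulf_neq0|rewrite -xz; ring].
have y20 : y2 = 0.
  by apply: (cancel (t * z2)); [rewrite mulf_neq0|rewrite -yz; ring].
subst x2 y2.
have d1 : x3 * y1 - x1 * y3 != 0.
  apply: contra (d0) => /eqP d1; apply/eqP.
  transitivity (z2 * (x3 * y1 - x1 * y3)); [ring|by rewrite d1 mulr0].
(* The equation from d * phi = 0 factors as t u (x3 y1 - x1 y3) (u x3 - (1 + u) y1) = 0. *)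
have x3E : u * x3 = (1 + u) * y1.
  apply/eqP; rewrite -subr_eq0; apply/eqP.
  apply: (cancel (t * u * (x3 * y1 - x1 * y3))); first by rewrite !mulf_neq0.
  move: sE => /eqP; rewrite -subr_eq0 => /eqP <-; rewrite EE FE GE rE; ring.
have x1E : u * x1 = - ((1 + u) * y3) by apply/eqP; rewrite -subr_eq0 opprK pE.
split=> //.
  apply: (cancel u) => //; rewrite FE.
  transitivity (t * ((u * x1) * y1 + (u * x3) * y3)); first by ring.
  by rewrite x1E x3E; ring.
transitivity (t * ((u * x1) ^+ 2 + (u * x3) ^+ 2)); last by rewrite EE; ring.
by rewrite x1E x3E GE; ring.
Qed.

(** If no pair met the specification, [xget] would return its default, the zero matrix, whereas the
    first diagonal entry here is 1. *)
Lemma g2_metric_spec (phi : extform R 7) r E F G :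
  g2_metric phi = n62R_metric r E F G -> g2_data_spec phi (g2_data phi).
Proof.
move=> gE; rewrite /g2_data; case: classical_sets.xgetP => [//|H].
exfalso; move: gE; rewrite /g2_metric /g2_data classical_sets.xgetPN // => /matrixP/(_ 0 0).
by rewrite n62R_metricE !mxE => /eqP; rewrite eq_sym oner_eq0.
Qed.

Lemma vol_coef_neq0 (phi : extform R 7) g o : g2_structure phi ->
  g2_data_spec phi (g, o) -> vol_coef g o != 0.
Proof.
move=> [_ phi_nd] [/= _ gP]; apply/eqP => s0.
pose v : 'rV[R]_7 := delta_mx 0 0.
have v0 : v != 0 by apply/eqP => /rowP/(_ 0)/eqP; rewrite !mxE eqxx oner_eq0.
have /eqP := phi_nd v v0; apply.
have := gP v v; rewrite /vol_form -/(vol_coef g o) s0 scale0r scaler0 => /esym/eqP.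
by rewrite scaler_eq0 invr_eq0 pnatr_eq0 /= => /eqP.
Qed.

Lemma purely_coclosed_metric (phi : extform R 7) (r E F G : R) : 0 < r -> 0 < E * G - F ^+ 2 ->
    g2_structure phi -> purely_coclosed (@n62R R) phi ->
    g2_metric phi = n62R_metric r E F G ->
  F = 0 /\ exists2 u, u = Num.sqrt r \/ u = - Num.sqrt r &
    G * (1 + u) ^+ 2 = E * r /\ 1 + u != 0.
Proof.
move=> r0 D0 g2 [coc pure] gE.
have := g2_metric_spec gE; move: coc gE; rewrite /g2_hodge /g2_metric.
case: (g2_data phi) => g o /= coc gE; rewrite {}gE in coc * => spec.
have s0 := vol_coef_neq0 g2 spec; have h3 := g2.1.
have := (g2_data_specE _ _ h3).1 spec; case=> _ H.
have [[e0 e1 e5 e15] e4 e11 eS] := (coclosedE h3 (lt0r_neq0 r0) (lt0r_neq0 D0) s0).1 coc.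
have {}pure := (pureE h3).1 pure.
set e := coord 3 phi in e0 e1 e5 e15 e4 e11 eS pure H.
set s := vol_coef _ o in s0 H.
have {}H i j : (i < 7)%N -> (j < 7)%N -> gram e i j = 6 * (metric_entry r E F G i j * s).
  move=> i7 j7; rewrite /gram; have := H (Ordinal i7) (Ordinal j7).
  by rewrite n62R_metricE mxE /= => ->.
clearbody e s; clear spec coc g2 h3 phi.
have q0 : Num.sqrt r != 0 by rewrite sqrtr_eq0 -ltNge.
have qr : Num.sqrt r ^+ 2 = r by rewrite sqr_sqrtr // ltW.
have s60 : 6 * s != 0 by rewrite mulf_neq0 ?pnatr_eq0.
have [|u [x1 [x2 [x3 [y1 [y2 [y3 [z1 [z2 [z3 [uq hX hY hZ d0]]]]]]]]]]] :=
    gram_split e0 e1 e5 e15 q0 s60.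
  move=> i j; case: i => [|[|[|[|//]]]] _; case: j => [|[|[|[|//]]]] _;
    by rewrite H // /metric_entry /= ?qr; ring.
have ur : r = u ^+ 2 by rewrite -qr; case: uq => ->; rewrite ?sqrrN.
have u0 : u != 0 by case: uq => ->; rewrite ?oppr_eq0.
have eL := gram_mixed e0 e1 e5 e15 u0 hX hY hZ d0.
have {}eL : forall k, k \in [:: 12; 22; 28; 31; 13; 23; 29; 32; 14; 24; 30; 33]%N -> e k = 0.
  apply: eL => i j; case: i => [|[|[|[|//]]]] _;
    case: j => [|[|[|[|[|[|[|//]]]]]]] // _;
    by rewrite H // /metric_entry /= !(mul0r, mulr0).
have eZ : forall k, k \in nonblock -> e k = 0.
  move=> k; rewrite -[X in k \in X]/([:: 0; 1; 5; 15]%N ++ _) mem_cat => /orP[|/eL//].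
  by rewrite !inE => /or4P[] /eqP->.
have [[g44 g55 g66] g45 g46 g56] := gram_center eZ hX hY hZ.
have pE := pure_split eZ hX hY hZ; rewrite {}pure in pE.
rewrite !H // /metric_entry /= in g44 g55 g66 g45 g46 g56.
(* Otherwise f7 would have length 0 instead of 1. *)
have c0 : e 34%N != 0.
  by apply/eqP => c0; move: g66; rewrite c0 => /eqP; rewrite !mulr0 !mul0r mul1r (negbTE s60).
case: hX hY hZ => [e2 e6 e16 [e25 e19 e9]] [e3 e7 e17 [e26 e20 e10]] [e4' e8 e18 [e27 e21 e11']].
have K a b : 6 * (a * s) = 6 * e 34%N * u * b -> a = e 34%N * u / s * b.
  move=> ab; apply: (mulfI s60); rewrite [RHS](_ : _ = 6 * e 34%N * u * b); last by field.
  by rewrite -ab; ring.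
have [] := @split_conclusion r u (e 34%N * u / s) E F G x1 x2 x3 y1 y2 y3 z1 z2 z3.
- exact: ur.
- exact: u0.
- by rewrite !mulf_neq0 ?invr_eq0.
- exact: d0.
- exact: K.
- exact: K.
- exact: K.
- exact/esym/K.
- exact/esym/K.
- by rewrite -e4'.
- by rewrite -[u * z3]e11' -e18.
- by rewrite -e10 -e9 -e3 -e2 -e16 -e17.
- by move/esym/eqP: pE; rewrite !mulf_eq0 (negbTE c0) pnatr_eq0 /= => /eqP.
by move=> F0 EG u1; split=> //; exists u; rewrite // ur.
Qed.
End Forward.

(** * Sufficiency: an explicit purely coclosed structure *)

Section Backward.
Variable R : realType.

Lemma form_of_basis (e : nat -> R) : (forall k, (35 <= k)%N -> e k = 0) ->
  let phi := form_of 7 e (basis_terms 7 3) in homog 3 phi /\ coord 3 phi = e.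
Proof.
move=> e35 phi; have h3 : homog 3 phi.
  move=> I; have [s sI -> I3] := mem_ksubsets I; rewrite form_ofE big_seq big1 // => m.
  case/mapP => t; rewrite mem_filter -supp_inj => /andP[/eqP ts /mapP[j jL tE]] _.
  case/negP: I3; rewrite -ts tE [(_, _).2]/= card_supp.
  have : nth [::] (ksubsets 7 3) j \in ksubsets 7 3.
    by apply: mem_nth; move: jL; rewrite mem_iota.
  by case/ksubsets_canon => sz ->; rewrite sz.
split=> //; apply/boolp.funext => k; have [k35|k35] := leqP 35 k.
  (* From index 35 on, [nth] returns the empty list, at which a 3-form has coefficient 0. *)
  rewrite /coord nth_default ?e35 // h3 //.
  by rewrite card_supp; vm_compute.
have H : all (fun j => coefs 7 (basis_terms 7 3) (nth [::] (ksubsets 7 3) j)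
    == [:: (false, [:: j])]) (iota 0 35) by vm_compute.
have /eqP ck : coefs 7 (basis_terms 7 3) (nth [::] (ksubsets 7 3) k) == [:: (false, [:: k])].
  by apply: (allP H); rewrite mem_iota.
by rewrite /coord /phi form_ofE ck big_seq1 /coef_val /= big_seq1.
Qed.

Definition diag_entries (r E G : R) : 'rV[R]_7 :=
  \row_j nth 0 [:: 1; 1; 1; r; E; G; 1] j.

Lemma n62R_metric_diag r E G : n62R_metric r E 0 G = diag_mx (diag_entries r E G).
Proof.
rewrite n62R_metricE; apply/matrixP => i j; rewrite !mxE.
case: i j => [[|[|[|[|[|[|[|//]]]]]]] ?] [[|[|[|[|[|[|[|//]]]]]]] ?];
  by rewrite /metric_entry -!val_eqE.
Qed.

Lemma inner_product_diag n (d : 'rV[R]_n) : (forall i, 0 < d 0 i) ->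
  inner_product (diag_mx d).
Proof.
move=> d0; split; first by rewrite tr_diag_mx.
move=> v v0.
have -> : bilin (diag_mx d) v v = \sum_i d 0 i * v 0 i ^+ 2.
  by rewrite /bilin mul_mx_diag !mxE; apply: eq_bigr => i _; rewrite !mxE; ring.
have t0 i : true -> 0 <= d 0 i * v 0 i ^+ 2 by rewrite mulr_ge0 ?sqr_ge0 // ltW.
rewrite lt0r sumr_ge0 // andbT psumr_eq0 //.
apply: contra v0 => /allP H; apply/eqP/rowP => i; rewrite mxE.
have := H i (mem_index_enum _); rewrite mulf_eq0 gt_eqF //= sqrf_eq0.
by move/eqP.
Qed.

(* m n f567 + m f5 (f23 + u f14) + n f6 (f12 + u f34) - f7 (f13 - u f24) *)
Definition witness (u m n : R) (k : nat) : R :=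
  nth 0 [:: 0; 0; 0; n; 0; 0; 0; 0; -1; u * m; 0; 0; 0; 0; 0; 0; m; 0; 0; 0;
            0; u; 0; 0; 0; 0; u * n; 0; 0; 0; 0; 0; 0; 0; m * n] k.

Lemma gram_witness (u m n : R) (i j : nat) : (i < 7)%N -> (j < 7)%N ->
  gram (witness u m n) i j =
  6 * (metric_entry (u ^+ 2) (m ^+ 2) 0 (n ^+ 2) i j * (u * m * n)).
Proof.
(* [Z] lists the zero coefficients of [witness]. *)
move=> i7 j7; pose Z := [:: 0; 1; 2; 4; 5; 6; 7; 10; 11; 12; 13; 14; 15; 17; 18; 19;
  20; 22; 23; 24; 25; 27; 28; 29; 30; 31; 32; 33]%N.
have wZ k : k \in Z -> witness u m n k = 0.
  rewrite !inE => kZ; repeat (case/orP: kZ => [/eqP->|kZ]; first reflexivity).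
  by move/eqP: kZ => ->.
rewrite /gram (sum_coef_vanish _ wZ) {wZ}.
case: i i7 => [|[|[|[|[|[|[|//]]]]]]] _; case: j j7 => [|[|[|[|[|[|[|//]]]]]]] _.
all: match goal with |- context [filter ?a ?l] => compute_in_goal (filter a l) end.
all: by rewrite unlock /coef_val unlock /witness /metric_entry /=; ring.
Qed.

Lemma exists_purely_coclosed (r u E G : R) : r = u ^+ 2 -> u != 0 -> 0 < 1 + u -> 0 < E -> 0 < G ->
    G * (1 + u) ^+ 2 = E * r ->
  exists phi : extform R 7, [/\ g2_structure phi, purely_coclosed (@n62R R) phi &
    g2_metric phi = n62R_metric r E 0 G].
Proof.
move=> rE u0 u1 E0 G0 EG.
(* The value of [m] is dictated by u x3 = (1 + u) y1 with x3 = m and y1 = n. It has the sign of u,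
   so that u m n = (1 + u) G is positive. *)
pose n := Num.sqrt G; pose m := (1 + u) * n / u.
have n2 : n ^+ 2 = G by rewrite sqr_sqrtr // ltW.
have m2 : m ^+ 2 = E.
  by rewrite /m expr_div_n exprMn n2 mulrC [_ * G]mulrC EG rE; field.
have s_gt0 : 0 < u * m * n.
  rewrite (_ : u * m * n = (1 + u) * G) ?mulr_gt0 //.
  by rewrite -n2 /m; field.
pose e := witness u m n.
pose phi := form_of 7 e (basis_terms 7 3).
have [h3 ce] : homog 3 phi /\ coord 3 phi = e.
  by apply: form_of_basis => k k35; rewrite /e /witness nth_default.
clearbody phi.
pose g := n62R_metric r E 0 G.
have r0 : 0 < r by rewrite rE exprn_even_gt0.
have gip : inner_product g.
  rewrite /g n62R_metric_diag; apply: inner_product_diag => i; rewrite mxE.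
  by case: i => [[|[|[|[|[|[|[|//]]]]]]] ?].
(* The determinant is u^2 E G = (u m n)^2, and positivity selects the root and the orientation. *)
have gs : vol_coef g false = u * m * n.
  rewrite /vol_coef /= expr0 mul1r /g n62R_metric_diag det_diag.
  rewrite !big_ord_recl big_ord0 !mxE /=.
  rewrite [X in Num.sqrt X](_ : _ = (u * m * n) ^+ 2) ?sqrtr_sqr ?gtr0_norm //.
  by rewrite rE -m2 -n2; ring.
have spec : g2_data_spec phi (g, false).
  apply/(g2_data_specE _ _ h3); split=> // i j; rewrite ce gs.
  rewrite -[RHS]/(gram e i j) gram_witness //; by rewrite /g n62R_metricE mxE rE m2 n2.
have g2 : g2_structure phi.
  split=> // v v0; have := spec.2 v v; rewrite /= /vol_form -/(vol_coef g false) gs.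
  apply: contra_eq_neq => ->; rewrite scaler0 scalerA.
  apply/eqP => /ffunP/(_ setT)/eqP; rewrite extform_scaleE !ffunE eqxx mulr1.
  by apply/negP/mulf_neq0; apply: lt0r_neq0 => //; apply: gip.2.
have data : g2_data phi = (g, false).
  apply: (g2_data_unique g2) => //.
  by apply: classical_sets.xgetPex; exists (g, false).
exists phi; split; rewrite /g2_metric /purely_coclosed /g2_hodge ?data //=.
have eZ : forall k, k \in nonblock -> e k = 0.
  move=> k; rewrite !inE => kZ; repeat (case/orP: kZ => [/eqP->|kZ]; first reflexivity).
  by move/eqP: kZ => ->.
have r_neq0 := lt0r_neq0 r0.
have D_neq0 : E * G - 0 ^+ 2 != 0 by rewrite expr0n subr0 mulf_neq0 ?gt_eqF.
have s_neq0 : vol_coef (n62R_metric r E 0 G) false != 0 by rewrite gs gt_eqF.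
split.
  apply: (coclosedE h3 r_neq0 D_neq0 s_neq0).2; rewrite ce /e /witness /=.
  have um : u * m = (1 + u) * n by rewrite /m; field.
  split; [by []|by []|by rewrite rE; ring|].
  by rewrite -m2 -n2 rE; transitivity (n * (u * m) ^+ 2); [ring|rewrite expr2 {2}um; ring].
apply: (pureE h3).2; rewrite ce.
(* X, Y, Z have coordinates (0, 0, m), (n, 0, 0), (0, -1, 0); x1 and y3 being zero, the condition
   holds. *)
rewrite (@pure_split _ e u 0 0 m n 0 0 0 (-1) 0) //; first by ring.
all: by rewrite /dual_type /e /witness /= ?mulr0 ?oppr0 ?mulrN1 ?opprK.
Qed.

End Backward.

Theorem proposition5p7 (R : realType) (r E F G : R)
    (r_gt0 : 0 < r) (r_le1 : r <= 1)
    (E_ge0 : 0 <= E) (F_ge0 : 0 <= F) (G_ge0 : 0 <= G)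
    (EGF : 0 < E * G - F ^+ 2) :
  (exists phi : extform R 7,
     [/\ g2_structure phi,
         purely_coclosed (@n62R R) phi
       & g2_metric phi = n62R_metric r E F G])
  <->
  (F = 0 /\
   ((G = E * (r / (Num.sqrt r + 1) ^+ 2) /\ 0 < r <= 1) \/
    (G = E * (r / (Num.sqrt r - 1) ^+ 2) /\ 0 < r < 1))).
Proof.
have q0 : 0 < Num.sqrt r by rewrite sqrtr_gt0.
have q2 : r = Num.sqrt r ^+ 2 by rewrite sqr_sqrtr // ltW.
split.
  case=> phi [g2 pc gE]; have [F0 [u uq [EG u1]]] :=
    purely_coclosed_metric r_gt0 EGF g2 pc gE.
  have {}EG : G = E * (r / (1 + u) ^+ 2).
    by apply: (mulIf (expf_neq0 2 u1)); rewrite EG; field.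
  split=> //; case: uq EG u1 => -> EG u1; [left|right].
    by rewrite addrC r_gt0.
  rewrite EG -[_ - 1]opprK opprB sqrrN r_gt0 lt_neqAle r_le1 andbT; split=> //.
  (* With u = - sqrt r, the value r = 1 would make 1 + u vanish. *)
  by apply: contra u1 => /eqP ->; rewrite sqrtr1 subrr.
case=> F0; rewrite {}F0 in EGF F_ge0 *; rewrite expr0n subr0 in EGF.
have E0 : 0 < E by rewrite lt0r E_ge0 andbT; apply: contraTneq EGF => ->; rewrite mul0r ltxx.
have G0 : 0 < G by rewrite lt0r G_ge0 andbT; apply: contraTneq EGF => ->; rewrite mulr0 ltxx.
case=> -[GE /andP[_ r1]].
  apply: (@exists_purely_coclosed _ r (Num.sqrt r)) => //; rewrite ?gt_eqF ?addr_gt0 //.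
  by rewrite GE; field; rewrite gt_eqF // addr_gt0.
(* For u = - sqrt r this is the positivity of 1 + u. *)
have q1 : Num.sqrt r < 1 by rewrite -[ltRHS]sqrtr1 ltr_sqrt.
apply: (@exists_purely_coclosed _ r (- Num.sqrt r)) => //.
- by rewrite sqrrN.
- by rewrite oppr_eq0 gt_eqF.
- by rewrite subr_gt0.
- by rewrite GE; field; rewrite subr_eq0 lt_eqF.
Qed.
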